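(* The parameterized problems \textsc{Grundy Domination}, \textsc{Total Grundy Domination}, \textsc{One-Sided Grundy Total Domination}, \textsc{L-Grundy Domination}, \textsc{Z-Grundy Domination}, and \textsc{Grundy Covering in Hypergraphs} are all in $\mathsf{W[3]}$.
   Context: For a graph $G$ and vertex $v$, $N(v)$ is the open and $N[v]=N(v)\cup\{v\}$ the closed neighborhood. A sequence $(v_1,\dots,v_k)$ of pairwise distinct vertices is: a \emph{dominating sequence} if for each $i$, $N[v_i]\setminus\bigcup_{j<i}N[v_j]\neq\emptyset$; a \emph{total dominating sequence} if $N(v_i)\setminus\bigcup_{j<i}N(v_j)\neq\emptyset$; a \emph{$Z$-sequence} if $N(v_i)\setminus\bigcup_{j<i}N[v_j]\neq\emptyset$; an \emph{$L$-sequence} if $N[v_i]\setminus\bigcup_{j<i}N(v_j)\neq\emptyset$. \textsc{Grundy Domination}, \textsc{Total Grundy Domination}, \textsc{Z-Grundy Domination}, \textsc{L-Grundy Domination}: input a graph $G$ and $k$ (parameter $k$), question whether $G$ has a dominating / total dominating / $Z$- / $L$-sequence of length at least $k$. \textsc{One-Sided Grundy Total Domination}: input a bipartite graph $G$ with bipartition $V(G)=A\,\dot\cup\,B$ and $k$ (parameter $k$), question whether there is a total dominating sequence of $G$ of length $k$ containing only vertices of $A$. For a hypergraph $\mathcal{H}=(X,\mathcal{E})$ with $\mathcal{E}\subseteq\mathcal{P}(X)$, a sequence $(C_1,\dots,C_k)$ of edges is a \emph{covering sequence} if $C_i\setminus\bigcup_{j<i}C_j\neq\emptyset$ for all $i$;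 \textsc{Grundy Covering in Hypergraphs}: input $\mathcal{H}$ and $k$ (parameter $k$), question whether $\mathcal{H}$ has a covering sequence of length at least $k$. $\mathsf{W[3]}$ is the standard class of the W-hierarchy (problems $\mathsf{FPT}$-reducible to weighted satisfiability of Boolean circuits of weft at most 3 and constant depth). *)

(* Defs.v *)
From mathcomp Require Import all_boot.
Set Implicit Arguments.
Unset Strict Implicit.
Unset Printing Implicit Defensive.

(** * Machine model

   Random access machines with addition, truncated subtraction and halving
   under the uniform cost measure (one time unit per instruction or test),
   the model of Flum and Grohe, "Parameterized Complexity Theory".  There is
   no multiplication, so the numbers occurring in t steps have O(t) more bits
   than the input and such a machine is polynomially equivalent to a Turing
   machine.  The output word is written one bit at a time, so its length never
   exceeds the running time.  Control flow is structured (if/while). *)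

Definition word := seq bool.

Inductive cmd : Type :=
  | Skip
  | Const of nat & nat          (* x := c *)
  | Add of nat & nat & nat      (* x := y + z *)
  | Sub of nat & nat & nat      (* x := y - z *)
  | Half of nat & nat           (* x := floor (y / 2) *)
  | Read of nat & nat           (* x := M[y] *)
  | Write of nat & nat          (* M[x] := y *)
  | Emit of nat                 (* append the bit (x != 0) to the output *)
  | Seq of cmd & cmd
  | If of nat & cmd & cmd       (* x != 0 ? *)
  | While of nat & cmd.         (* while x != 0 *)

Record state := State { regs : nat -> nat; mem : nat -> nat; out : word }.

Definition upd (m : nat -> nat) (i v : nat) : nat -> nat :=
  fun j => if j == i then v else m j.

Definition set_reg (s : state) (x v : nat) : state :=
  State (upd (regs s) x v) (mem s) (out s).

(* [exec c s s' t]: started in s, the program c halts in s' after t steps. *)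
Inductive exec : cmd -> state -> state -> nat -> Prop :=
  | ExSkip s : exec Skip s s 1
  | ExConst x c s : exec (Const x c) s (set_reg s x c) 1
  | ExAdd x y z s : exec (Add x y z) s (set_reg s x (regs s y + regs s z)) 1
  | ExSub x y z s : exec (Sub x y z) s (set_reg s x (regs s y - regs s z)) 1
  | ExHalf x y s : exec (Half x y) s (set_reg s x (regs s y)./2) 1
  | ExRead x y s : exec (Read x y) s (set_reg s x (mem s (regs s y))) 1
  | ExWrite x y s :
      exec (Write x y) s
        (State (regs s) (upd (mem s) (regs s x) (regs s y)) (out s)) 1
  | ExEmit x s :
      exec (Emit x) s (State (regs s) (mem s) (rcons (out s) (regs s x != 0))) 1
  | ExSeq c1 c2 s1 s2 s3 t1 t2 :
      exec c1 s1 s2 t1 -> exec c2 s2 s3 t2 -> exec (Seq c1 c2) s1 s3 (t1 + t2)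
  | ExIfT x c1 c2 s s' t :
      regs s x != 0 -> exec c1 s s' t -> exec (If x c1 c2) s s' t.+1
  | ExIfF x c1 c2 s s' t :
      regs s x = 0 -> exec c2 s s' t -> exec (If x c1 c2) s s' t.+1
  | ExWhileF x c s : regs s x = 0 -> exec (While x c) s s 1
  | ExWhileT x c s1 s2 s3 t1 t2 :
      regs s1 x != 0 -> exec c s1 s2 t1 -> exec (While x c) s2 s3 t2 ->
      exec (While x c) s1 s3 (t1 + t2).+1.

(* The input word is stored bit by bit in memory, its length is in register 0
   and the parameter in register 1.  A resulting number is read off
   register 1. *)
Definition init (x : word) (k : nat) : state :=
  State (fun r => if r == 0 then size x else if r == 1 then k else 0)
        (fun i => nth false x i : nat) [::].

Definition computable (h : nat -> nat) : Prop :=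
  exists c : cmd, forall k, exists s t,
    exec c (init [::] k) s t /\ regs s 1 = h k.

(** * Parameterized problems, fpt-reductions and the W-hierarchy *)

Definition pproblem := word -> nat -> Prop.

Definition fpt_reducible (P Q : pproblem) : Prop :=
  exists (c : cmd) (f g : nat -> nat) (e : nat),
    [/\ computable f, computable g &
        forall (x : word) (k : nat), exists (s : state) (t : nat),
          [/\ exec c (init x k) s t,
              t <= f k * (size x).+1 ^ e,
              regs s 1 <= g k &
              P x k <-> Q (out s) (regs s 1)]].

(* A circuit lists its gates in topological order; a gate refers to earlier
   gates by their positions, and the last gate is the output.  Conjunctions and
   disjunctions of fan-in 0 serve as the Boolean constants. *)
Inductive gate : Type :=
  | GInput
  | GNot of nat
  | GAnd of seq nat
  | GOr of seq nat.

Definition circuit := seq gate.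

Definition is_input (g : gate) : bool := if g is GInput then true else false.

Definition fanin (g : gate) : seq nat :=
  match g with
  | GInput => [::]
  | GNot j => [:: j]
  | GAnd js | GOr js => js
  end.

Definition wf_circuit (C : circuit) : bool :=
  (0 < size C) &&
  all (fun i => all (fun j => j < i) (fanin (nth GInput C i))) (iota 0 (size C)).

(* [gate_values step C] is the sequence of values of the gates of C, where the
   value of a gate is obtained by [step] from those of the preceding gates. *)
Definition gate_values (V : Type) (step : seq V -> gate -> V) (C : circuit) :
    seq V :=
  foldl (fun vs g => rcons vs (step vs g)) [::] C.

(* The assignment a gives to the input gate at position i the value a i. *)
Definition eval_circuit (a : nat -> bool) (C : circuit) : bool :=
  last false (gate_values (fun vs g =>
    match g with
    | GInput => a (size vs)
    | GNot j => ~~ nth false vs j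
    | GAnd js => all (nth false vs) js
    | GOr js => has (nth false vs) js
    end) C).

Definition weight (a : nat -> bool) (C : circuit) : nat :=
  count (fun i => is_input (nth GInput C i) && a i) (iota 0 (size C)).

Definition large (g : gate) : bool := 2 < size (fanin g).

Definition depth (C : circuit) : nat :=
  last 0 (gate_values (fun ds g =>
    (~~ is_input g) + \max_(j <- fanin g) nth 0 ds j) C).

Definition weft (C : circuit) : nat :=
  last 0 (gate_values (fun ws g =>
    large g + \max_(j <- fanin g) nth 0 ws j) C).

Definition enc_nat (n : nat) : word := rcons (nseq n true) false.

Definition enc_seq (js : seq nat) : word :=
  enc_nat (size js) ++ flatten (map enc_nat js).

Definition enc_gate (g : gate) : word :=
  match g with
  | GInput => [:: false; false]
  | GNot j => [:: false; true] ++ enc_nat j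
  | GAnd js => [:: true; false] ++ enc_seq js
  | GOr js => [:: true; true] ++ enc_seq js
  end.

Definition enc_circuit (C : circuit) : word :=
  enc_nat (size C) ++ flatten (map enc_gate C).

(* Weighted satisfiability of circuits of weft at most t and depth at most d. *)
Definition wcs (t d : nat) : pproblem := fun x k =>
  exists C : circuit,
    [/\ x = enc_circuit C, wf_circuit C, weft C <= t, depth C <= d &
        exists a : nat -> bool, weight a C = k /\ eval_circuit a C].

Definition in_W (t : nat) (P : pproblem) : Prop :=
  exists d : nat, fpt_reducible P (wcs t d).

(** * Sequences in graphs and hypergraphs *)

Record graph := Graph {
  order : nat;
  adj : rel 'I_order;
  adj_sym : symmetric adj;
  adj_irr : irreflexive adj }.

Definition vertex (G : graph) := 'I_(order G).

Definition opn (G : graph) (v : vertex G) : {set vertex G} :=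
  [set u | adj v u].

Definition cln (G : graph) (v : vertex G) : {set vertex G} := v |: opn v.

(* P(v_i) is not covered by the union of the Q(v_j) for j < i. *)
Definition footprinting (S T : finType) (P Q : S -> {set T}) (m : nat)
    (s : m.-tuple S) : Prop :=
  forall i : 'I_m,
    P (tnth s i) :\: \bigcup_(j < m | j < i) Q (tnth s j) != set0.

Definition dominating_sequence (G : graph) m (s : m.-tuple (vertex G)) : Prop :=
  uniq s /\ footprinting (@cln G) (@cln G) s.

Definition total_dominating_sequence (G : graph) m (s : m.-tuple (vertex G)) :
    Prop :=
  uniq s /\ footprinting (@opn G) (@opn G) s.

Definition Z_sequence (G : graph) m (s : m.-tuple (vertex G)) : Prop :=
  uniq s /\ footprinting (@opn G) (@cln G) s.

Definition L_sequence (G : graph) m (s : m.-tuple (vertex G)) : Prop :=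
  uniq s /\ footprinting (@cln G) (@opn G) s.

Definition covering_sequence (n : nat) (E : {set {set 'I_n}}) m
    (s : m.-tuple {set 'I_n}) : Prop :=
  {subset s <= E} /\ footprinting (fun C => C) (fun C => C) s.

Definition bipartition (G : graph) (A B : {set vertex G}) : Prop :=
  [/\ A :|: B = setT, [disjoint A & B] &
      forall u v : vertex G, adj u v -> (u \in A) = (v \in B)].

(** * The problems *)

(* Adjacency matrix, row by row, preceded by the order in unary. *)
Definition enc_graph (G : graph) : word :=
  enc_nat (order G) ++
  [seq adj u v | u <- enum 'I_(order G), v <- enum 'I_(order G)].

Definition enc_set (n : nat) (A : {set 'I_n}) : word :=
  [seq v \in A | v <- enum 'I_n].

(* The edges may be listed in any order, possibly with repetitions. *)
Definition enc_hypergraph (n : nat) (Es : seq {set 'I_n}) : word :=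
  enc_nat n ++ enc_nat (size Es) ++ flatten (map (@enc_set n) Es).

Definition grundy_domination : pproblem := fun x k =>
  exists G : graph, x = enc_graph G /\
    exists m (s : m.-tuple (vertex G)), k <= m /\ dominating_sequence s.

Definition total_grundy_domination : pproblem := fun x k =>
  exists G : graph, x = enc_graph G /\
    exists m (s : m.-tuple (vertex G)), k <= m /\ total_dominating_sequence s.

Definition Z_grundy_domination : pproblem := fun x k =>
  exists G : graph, x = enc_graph G /\
    exists m (s : m.-tuple (vertex G)), k <= m /\ Z_sequence s.

Definition L_grundy_domination : pproblem := fun x k =>
  exists G : graph, x = enc_graph G /\
    exists m (s : m.-tuple (vertex G)), k <= m /\ L_sequence s.

Definition one_sided_grundy_total_domination : pproblem := fun x k =>
  exists (G : graph) (A B : {set vertex G}),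
    [/\ x = enc_graph G ++ enc_set A, bipartition A B &
        exists s : k.-tuple (vertex G),
          total_dominating_sequence s /\ {subset s <= A}].

Definition grundy_covering : pproblem := fun x k =>
  exists (n : nat) (Es : seq {set 'I_n}),
    x = enc_hypergraph Es /\
    exists m (s : m.-tuple {set 'I_n}),
      k <= m /\ covering_sequence [set C in Es] s.

(* Main.v *)
From mathcomp Require Import all_boot zify.
Require Import Defs.
Set Implicit Arguments.
Unset Strict Implicit.
Unset Printing Implicit Defensive.

(** Guess, together with the i-th element u_i of the sequence, a witness w_i that
    belongs to P(u_i) but to no Q(u_j) with j < i.  Then every condition involves
    at most two of the k guesses, so a circuit whose inputs are the triples
    (i, u, w) only has to reject the assignments of weight k that contain one of
    polynomially many forbidden pairs.  Such a circuit has weft 1 and depth 3.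

    The reduction is a program of a small language (expressions with sums over
    ranges, and loops that emit bits without mutable variables) in which every
    value and every running time is polynomially bounded; compiling this
    language to the machine model settles the running time once and for all. *)

(** * Programs with time bounds *)

(** A footprinting sequence stays one when it is cut after [k] elements, so a length of at least [k]
    can be replaced by exactly [k] positions, and the parameter is passed on unchanged. Naming the
    witnesses in the inputs turns the nonemptiness of a set difference, a statement quantified over
    vertices, into conditions on pairs of inputs; the bound 3 on the weft is therefore met with
    slack. That an assignment encodes a sequence at all comes from its weight: two inputs for one
    position conflict, so [k] true inputs fill each of the [k] positions exactly once. The problems
    are predicates on words, so the program must also recognise malformed words; for these it emits
    the empty word, which encodes no circuit. Mutable variables would permit repeated squaring in a
    loop. Here a value is passed only into the scope of its binder, so multiplication is harmless;
    quotients and unary headers are computed as sums of 0/1 conditions. *)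

Definition poly_bounded (f : nat -> nat) : Prop :=
  exists c, forall m, f m <= m.+2 ^ c.

Lemma poly_bounded_id : poly_bounded id.
Proof. by exists 1 => m; rewrite expn1; lia. Qed.

Lemma poly_bounded_const c : poly_bounded (fun=> c).
Proof.
exists c => m; apply: leq_trans (ltnW (ltn_expl c (isT : 1 < 2))) _.
by case: c => // c; rewrite leq_exp2r.
Qed.

Lemma poly_bounded_add f g :
  poly_bounded f -> poly_bounded g -> poly_bounded (fun m => f m + g m).
Proof.
move=> [a fa] [b gb]; exists (a + b).+1 => m.
have ma : m.+2 ^ a <= m.+2 ^ (a + b) by rewrite leq_pexp2l ?leq_addr.
have mb : m.+2 ^ b <= m.+2 ^ (a + b) by rewrite leq_pexp2l ?leq_addl.
have := fa m; have := gb m; rewrite expnS; nia.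
Qed.

Lemma poly_bounded_mul f g :
  poly_bounded f -> poly_bounded g -> poly_bounded (fun m => f m * g m).
Proof.
move=> [a fa] [b gb]; exists (a + b) => m.
by rewrite expnD leq_mul.
Qed.

Lemma poly_bounded_comp f g :
  poly_bounded f -> poly_bounded g -> poly_bounded (fun m => f (g m)).
Proof.
(* [g m + 2] is at most [3 * m.+2 ^ b], so two further factors [m.+2] absorb the shift in the
   base. *)
move=> [a fa] [b gb]; exists (b.+2 * a) => m; apply: leq_trans (fa _) _.
rewrite expnM; case: a {fa} => // a; rewrite leq_exp2r //.
have := gb m; have : 0 < m.+2 ^ b by rewrite expn_gt0.
rewrite ?expnS; nia.
Qed.

Definition runs (c : cmd) (s : state) (Q : state -> Prop) (T : nat) : Prop :=
  exists s' t, [/\ exec c s s' t, t <= T & Q s'].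

Lemma runs_weaken c s (Q Q' : state -> Prop) T T' :
  runs c s Q T -> T <= T' -> (forall s', Q s' -> Q' s') -> runs c s Q' T'.
Proof.
move=> [s' [t [ex tT Qs']]] TT' QQ'; exists s', t; split=> //.
  exact: leq_trans tT TT'.
exact: QQ'.
Qed.

Lemma runs_seq c1 c2 s (Q1 Q2 : state -> Prop) T1 T2 :
  runs c1 s Q1 T1 -> (forall s', Q1 s' -> runs c2 s' Q2 T2) ->
  runs (Seq c1 c2) s Q2 (T1 + T2).
Proof.
move=> [s1 [t1 [ex1 le1 Q1s]]] /(_ _ Q1s) [s2 [t2 [ex2 le2 Q2s]]].
exists s2, (t1 + t2); split=> //; first exact: ExSeq ex1 ex2.
exact: leq_add.
Qed.

Lemma runs_skip s (Q : state -> Prop) : Q s -> runs Skip s Q 1.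
Proof. by move=> Qs; exists s, 1; split=> //; constructor. Qed.

Lemma runs_const x c s (Q : state -> Prop) :
  Q (set_reg s x c) -> runs (Const x c) s Q 1.
Proof. by move=> Qs; exists (set_reg s x c), 1; split=> //; constructor. Qed.

Lemma runs_add x y z s (Q : state -> Prop) :
  Q (set_reg s x (regs s y + regs s z)) -> runs (Add x y z) s Q 1.
Proof. by move=> Qs; eexists _, 1; split; [constructor| |exact: Qs]. Qed.

Lemma runs_sub x y z s (Q : state -> Prop) :
  Q (set_reg s x (regs s y - regs s z)) -> runs (Sub x y z) s Q 1.
Proof. by move=> Qs; eexists _, 1; split; [constructor| |exact: Qs]. Qed.

Lemma runs_read x y s (Q : state -> Prop) :
  Q (set_reg s x (mem s (regs s y))) -> runs (Read x y) s Q 1.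
Proof. by move=> Qs; eexists _, 1; split; [constructor| |exact: Qs]. Qed.

Lemma runs_emit x s (Q : state -> Prop) :
  Q (State (regs s) (mem s) (rcons (out s) (regs s x != 0))) ->
  runs (Emit x) s Q 1.
Proof. by move=> Qs; eexists _, 1; split; [constructor| |exact: Qs]. Qed.

(** Charging both branches, by a sum rather than a maximum, keeps time bounds within the operations
    under which [poly_bounded] is shown to be closed. *)
Lemma runs_if x c1 c2 s (Q : state -> Prop) T1 T2 :
  (regs s x != 0 -> runs c1 s Q T1) -> (regs s x = 0 -> runs c2 s Q T2) ->
  runs (If x c1 c2) s Q (T1 + T2).+1.
Proof.
move=> runsT runsF; have [x0|x0] := boolP (regs s x == 0).
  have [s' [t [ex le Qs]]] := runsF (eqP x0).
  exists s', t.+1; split=> //; first exact: ExIfF (eqP x0) ex.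
  by rewrite ltnS; apply: leq_trans le _; rewrite leq_addl.
have [s' [t [ex le Qs]]] := runsT x0.
exists s', t.+1; split=> //; first exact: ExIfT.
by rewrite ltnS; apply: leq_trans le _; rewrite leq_addr.
Qed.

(** Every compiled loop counts a register down, so its number of rounds is known on entry; the
    invariant is indexed by the rounds already done. Each round pays one step for its test, and the
    failing last test pays one more. *)
Lemma runs_while d c (I : nat -> state -> Prop) n s T :
  regs s d = n -> I 0 s ->
  (forall i s, i < n -> regs s d = n - i -> I i s ->
     runs c s (fun s' => regs s' d = n - i.+1 /\ I i.+1 s') T) ->
  runs (While d c) s (fun s' => regs s' d = 0 /\ I n s') (n * T.+1).+1.
Proof.
move=> dn I0 step.
suff gen j i s' : i + j = n -> regs s' d = j -> I i s' ->
    runs (While d c) s' (fun s' => regs s' d = 0 /\ I n s') (j * T.+1).+1.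
  exact: (gen n 0 s).
elim: j i s' => [|j IHj] i s' ijn ds' Ii.
  exists s', 1; split=> //; first exact: ExWhileF.
  by split=> //; rewrite -ijn addn0.
have [s1 [t1 [ex1 le1 [d1 I1]]]] :
    runs c s' (fun s' => regs s' d = n - i.+1 /\ I i.+1 s') T.
  by apply: step => //; lia.
have [s2 [t2 [ex2 le2 Q2]]] :
    runs (While d c) s1 (fun s' => regs s' d = 0 /\ I n s') (j * T.+1).+1.
  by apply: (IHj i.+1) => //; lia.
exists s2, (t1 + t2).+1; split=> //; last by nia.
by apply: ExWhileT ex1 ex2; rewrite ds'.
Qed.

(** * A language of polynomial-time transductions *)

(* Variables are numbered from the outermost binder; [Sum a b] is the sum of
   the values of b for the innermost variable ranging over 0 .. a - 1. *)
Inductive expr :=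
  | Var of nat
  | Cst of nat
  | Plus of expr & expr
  | Minus of expr & expr
  | Times of expr & expr
  | Bit of expr
  | Sum of expr & expr.

Fixpoint eval (x : word) (e : expr) (env : seq nat) : nat :=
  match e with
  | Var i => nth 0 env i
  | Cst c => c
  | Plus a b => eval x a env + eval x b env
  | Minus a b => eval x a env - eval x b env
  | Times a b => eval x a env * eval x b env
  | Bit a => nth false x (eval x a env)
  | Sum a b => \sum_(i < eval x a env) eval x b (rcons env i)
  end.

Inductive emitter :=
  | Put of expr
  | Then of emitter & emitter
  | Branch of expr & emitter & emitter
  | Bind of expr & emitter
  | For of expr & emitter.

Fixpoint emitted (x : word) (p : emitter) (env : seq nat) : word :=
  match p with
  | Put e => [:: eval x e env != 0]
  | Then p q => emitted x p env ++ emitted x q env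
  | Branch e p q =>
      if eval x e env != 0 then emitted x p env else emitted x q env
  | Bind e p => emitted x p (rcons env (eval x e env))
  | For e p =>
      flatten [seq emitted x p (rcons env i) | i <- iota 0 (eval x e env)]
  end.

(** A function of a single number, since the environment enters only through a bound [m] on its
    entries. The variable bound by [Sum] stays below [val_bound a m], so [m + val_bound a m] bounds
    the extended environment. *)
Fixpoint val_bound (e : expr) (m : nat) : nat :=
  match e with
  | Var _ => m
  | Cst c => c
  | Plus a b => val_bound a m + val_bound b m
  | Minus a _ => val_bound a m
  | Times a b => val_bound a m * val_bound b m
  | Bit _ => 1
  | Sum a b => val_bound a m * val_bound b (m + val_bound a m)
  end.

Lemma eval_le x e env m :
  all (leq^~ m) env -> eval x e env <= val_bound e m.
Proof.
elim: e env m => //=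
  [i|a IHa b IHb|a IHa b IHb|a IHa b IHb|a IHa|a IHa b IHb] env m le_m.
- case: (ltnP i (size env)) => [lt_i|ge_i]; last by rewrite nth_default.
  exact: (all_nthP 0 le_m).
- by rewrite leq_add ?IHa ?IHb.
- by apply: leq_trans (leq_subr _ _) _; apply: IHa.
- by rewrite leq_mul ?IHa ?IHb.
- exact: leq_b1.
- apply: (@leq_trans (\sum_(i < eval x a env) val_bound b (m + val_bound a m))).
    apply: leq_sum => i _; apply: IHb; rewrite all_rcons.
    have := ltn_ord i; have := IHa _ _ le_m => h1 h2.
    apply/andP; split; first by lia.
    by apply: sub_all le_m => j; lia.
  by rewrite sum_nat_const card_ord leq_mul2r IHa ?orbT.
Qed.

Lemma val_bound_poly e : poly_bounded (val_bound e).
Proof.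
elim: e => [i|c|a IHa b IHb|a IHa b IHb|a IHa b IHb|a IHa|a IHa b IHb] //=.
- exact: poly_bounded_id.
- exact: poly_bounded_const.
- exact: poly_bounded_add.
- exact: poly_bounded_mul.
- exact: poly_bounded_const.
- apply: poly_bounded_mul => //.
  apply: (@poly_bounded_comp _ (fun m => m + val_bound a m)) => //.
  exact: poly_bounded_add poly_bounded_id IHa.
Qed.

(* Variable i is held in register [nth 0 vs i]; the value is left in register d
   and only registers from d on are modified. *)
Fixpoint compile_expr (vs : seq nat) (d : nat) (e : expr) : cmd :=
  match e with
  | Var i =>
      Seq (Const d 0) (if i < size vs then Add d (nth 0 vs i) d else Skip)
  | Cst c => Const d c
  | Plus a b =>
      Seq (compile_expr vs d a) (Seq (compile_expr vs d.+1 b) (Add d d d.+1))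
  | Minus a b =>
      Seq (compile_expr vs d a) (Seq (compile_expr vs d.+1 b) (Sub d d d.+1))
  | Times a b =>
      Seq (compile_expr vs d a) (Seq (compile_expr vs d.+1 b)
      (Seq (Const d.+2 0) (Seq (Const d.+3 1)
      (Seq (While d.+1 (Seq (Add d.+2 d.+2 d) (Sub d.+1 d.+1 d.+3)))
           (Add d d.+2 d.+1)))))
  | Bit a => Seq (compile_expr vs d a) (Read d d)
  | Sum a b =>
      Seq (compile_expr vs d a)
      (Seq (Const d.+1 0) (Seq (Const d.+2 0)
      (Seq (While d
             (Seq (compile_expr (rcons vs d.+1) d.+3 b)
             (Seq (Add d.+2 d.+2 d.+3) (Seq (Const d.+3 1)
             (Seq (Add d.+1 d.+1 d.+3) (Sub d d d.+3))))))
           (Add d d.+2 d))))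
  end.

(** The machine cannot multiply, so a product is computed by repeated addition in time proportional
    to the value of its second factor. Time bounds are thus polynomial only because values are. *)
Fixpoint time_bound (e : expr) (m : nat) : nat :=
  match e with
  | Var _ => 2
  | Cst _ => 1
  | Plus a b | Minus a b => time_bound a m + (time_bound b m + 1)
  | Times a b => time_bound a m + (time_bound b m + (val_bound b m * 3 + 4))
  | Bit a => time_bound a m + 1
  | Sum a b =>
      time_bound a m +
      (val_bound a m * (time_bound b (m + val_bound a m) + 5) + 4)
  end.

Lemma time_bound_poly e : poly_bounded (time_bound e).
Proof.
elim: e => [i|c|a IHa b IHb|a IHa b IHb|a IHa b IHb|a IHa|a IHa b IHb] /=;
  repeat (apply: poly_bounded_add || apply: poly_bounded_mul
          || exact: poly_bounded_const || exact: val_bound_poly) => //.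
apply: (@poly_bounded_comp _ (fun m => m + val_bound a m)) => //.
exact: poly_bounded_add poly_bounded_id (val_bound_poly a).
Qed.

Definition keeps (d : nat) (s s' : state) : Prop :=
  (forall r, r < d -> regs s' r = regs s r) /\ mem s' = mem s.

Lemma keeps_refl d s : keeps d s s.
Proof. by []. Qed.

Lemma keeps_trans d s1 s2 s3 : keeps d s1 s2 -> keeps d s2 s3 -> keeps d s1 s3.
Proof.
move=> [r12 m12] [r23 m23]; split; last by rewrite m23.
by move=> r lt_r; rewrite r23 ?r12.
Qed.

Lemma keeps_leq d d' s s' : d <= d' -> keeps d' s s' -> keeps d s s'.
Proof. by move=> le_d [rs ms]; split=> // r lt_r; apply: rs; apply: leq_trans le_d. Qed.

Lemma keeps_set_reg d s x v : d <= x -> keeps d s (set_reg s x v).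
Proof. by move=> le_dx; split=> // r lt_r /=; rewrite /upd; case: eqP => //; lia. Qed.

Lemma keeps_env d s s' vs :
  keeps d s s' -> all (ltn^~ d) vs -> map (regs s') vs = map (regs s) vs.
Proof.
move=> [rs _] /allP lt_vs; apply/eq_in_map => r r_vs.
by apply: rs; apply: lt_vs.
Qed.

Lemma all_ltn_trans d d' (vs : seq nat) :
  d <= d' -> all (ltn^~ d) vs -> all (ltn^~ d') vs.
Proof. by move=> le_d; apply: sub_all => r lt_r; apply: leq_trans le_d. Qed.

Definition bits (x : word) (i : nat) : nat := nth false x i.

Definition expr_post x e vs d s s' : Prop :=
  [/\ keeps d s s', out s' = out s & regs s' d = eval x e (map (regs s) vs)].

Lemma upd_same f i v : upd f i v i = v.
Proof. by rewrite /upd eqxx. Qed.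

Lemma upd_other f i j v : j != i -> upd f i v j = f j.
Proof. by rewrite /upd => /negPf ->. Qed.

Lemma compile_exprP x e vs d s m :
  all (ltn^~ d) vs -> mem s = bits x -> all (leq^~ m) (map (regs s) vs) ->
  runs (compile_expr vs d e) s (expr_post x e vs d s) (time_bound e m).
Proof.
elim: e vs d s m => [i|c|a IHa b IHb|a IHa b IHb|a IHa b IHb|a IHa|a IHa b IHb]
  vs d s m lt_vs ms le_m /=.
- apply: (runs_seq (T1 := 1) (T2 := 1)); first by apply: runs_const; exact: erefl.
  move=> _ <-; case: ltnP => [lt_i|ge_i].
    apply: runs_add; split=> //=.
      apply: keeps_trans (keeps_set_reg _ _ (leqnn d)) (keeps_set_reg _ _ (leqnn d)).
    rewrite (nth_map 0) //.
    have lt_id : nth 0 vs i < d by apply: (allP lt_vs); rewrite mem_nth.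
    by rewrite !upd_same addn0 upd_other //; lia.
  apply: runs_skip; split=> //=; first exact: keeps_set_reg.
  by rewrite upd_same nth_default ?size_map.
- by apply: runs_const; split=> //=; [exact: keeps_set_reg | rewrite upd_same].
- apply: runs_seq (IHa _ _ _ _ lt_vs ms le_m) _ => s1 [k1 o1 r1].
  have e1 := keeps_env k1 lt_vs.
  apply: runs_seq (IHb vs d.+1 s1 m _ _ _) _; rewrite ?e1 //.
  + exact: all_ltn_trans (leqnSn d) lt_vs.
  + by case: k1 => _ ->.
  move=> s2 [k2 o2 r2]; apply: runs_add; split=> /=.
  + apply: keeps_trans (keeps_set_reg _ _ (leqnn d)).
    exact: keeps_trans k1 (keeps_leq (leqnSn d) k2).
  + by rewrite o2.
  + by rewrite upd_same r2 e1 -r1; case: k2 => ->.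
- apply: runs_seq (IHa _ _ _ _ lt_vs ms le_m) _ => s1 [k1 o1 r1].
  have e1 := keeps_env k1 lt_vs.
  apply: runs_seq (IHb vs d.+1 s1 m _ _ _) _; rewrite ?e1 //.
  + exact: all_ltn_trans (leqnSn d) lt_vs.
  + by case: k1 => _ ->.
  move=> s2 [k2 o2 r2]; apply: runs_sub; split=> /=.
  + apply: keeps_trans (keeps_set_reg _ _ (leqnn d)).
    exact: keeps_trans k1 (keeps_leq (leqnSn d) k2).
  + by rewrite o2.
  + by rewrite upd_same r2 e1 -r1; case: k2 => ->.
- have le_b := eval_le x b le_m.
  apply: runs_seq (IHa _ _ _ _ lt_vs ms le_m) _ => s1 [k1 o1 r1].
  have e1 := keeps_env k1 lt_vs.
  apply: runs_seq (IHb vs d.+1 s1 m _ _ _) _; rewrite ?e1 //.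
  + exact: all_ltn_trans (leqnSn d) lt_vs.
  + by case: k1 => _ ->.
  move=> s2 [k2 o2 r2].
  set va := eval x a _ in r1 *; set vb := eval x b _ in le_b.
  have r2a : regs s2 d = va by case: k2 => -> //.
  rewrite e1 -/vb in r2.
  have k12 := keeps_trans k1 (keeps_leq (leqnSn d) k2).
  apply: (@runs_weaken _ _ _ _ (1 + (1 + ((vb * 3).+1 + 1))));
    [|by lia|move=> s' h; exact: h].
  apply: runs_seq; first by apply: runs_const; exact: erefl.
  move=> _ <-; apply: runs_seq; first by apply: runs_const; exact: erefl.
  move=> _ <-.
  (* [d.+2] accumulates the product, [d.+1] counts down, and [d.+3] holds the 1 by which it is
     decremented. *)
  pose I i s' := [/\ keeps d s s', out s' = out s, regs s' d = va,
    regs s' d.+2 = va * i & regs s' d.+3 = 1].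
  apply: (runs_seq (runs_while (I := I) (n := vb) (T := 2) _ _ _)).
  + by rewrite /= /upd !eqn_leq /=; do !case: ifP => //; lia.
  + split=> /=; rewrite ?o2 ?o1 //.
    * apply: (keeps_trans k12).
      by apply: keeps_trans (keeps_set_reg _ _ _) (keeps_set_reg _ _ _); lia.
    * by rewrite !upd_other //; lia.
    * by rewrite upd_other ?upd_same ?muln0; lia.
    * by rewrite upd_same.
  + move=> i s3 lt_i r3 [k3 o3 a3 b3 c3].
    apply: (runs_seq (T1 := 1) (T2 := 1)); first by apply: runs_add; exact: erefl.
    move=> _ <-; apply: runs_sub; split=> /=.
      by rewrite upd_same !upd_other ?r3 ?c3; lia.
    split=> //=.
    * apply: (keeps_trans k3).
      by apply: keeps_trans (keeps_set_reg _ _ _) (keeps_set_reg _ _ _); lia.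
    * by rewrite !upd_other //; lia.
    * by rewrite upd_other ?upd_same ?a3 ?b3; lia.
    * by rewrite !upd_other //; lia.
  (* The countdown register is 0 on exit, so adding it to the accumulator amounts to a copy into
     [d]. *)
  + move=> s3 [r3 [k3 o3 a3 b3 c3]]; apply: runs_add; split=> //=.
      exact: keeps_trans k3 (keeps_set_reg _ _ (leqnn d)).
    by rewrite upd_same b3 r3 addn0.
- apply: runs_seq (IHa _ _ _ _ lt_vs ms le_m) _ => s1 [k1 o1 r1].
  apply: runs_read; split=> //=.
    exact: keeps_trans k1 (keeps_set_reg _ _ (leqnn d)).
  by rewrite upd_same r1; case: k1 => _ ->; rewrite ms.
- have le_a := eval_le x a le_m.
  apply: runs_seq (IHa _ _ _ _ lt_vs ms le_m) _ => s1 [k1 o1 r1].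
  set va := eval x a _ in r1 le_a *; set M := m + _; set tb := time_bound b M.
  apply: (@runs_weaken _ _ _ _ (1 + (1 + ((va * (tb + 4).+1).+1 + 1))));
    [|by nia|move=> s' h; exact: h].
  apply: runs_seq; first by apply: runs_const; exact: erefl.
  move=> _ <-; apply: runs_seq; first by apply: runs_const; exact: erefl.
  move=> _ <-.
  (* [d] counts down while [d.+1] runs upwards as the bound variable. Register [d.+3] serves twice
     per round, for the value of [b] and then for the constant 1. *)
  pose I i s' := [/\ keeps d s s', out s' = out s, regs s' d.+1 = i &
    regs s' d.+2 = \sum_(j < i) eval x b (rcons (map (regs s) vs) j)].
  apply: (runs_seq (runs_while (I := I) (n := va) (T := tb + 4) _ _ _)).
  + by rewrite /= !upd_other //; lia.
  + split=> /=; rewrite ?o1 //.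
    * apply: (keeps_trans k1).
      by apply: keeps_trans (keeps_set_reg _ _ _) (keeps_set_reg _ _ _); lia.
    * by rewrite upd_other ?upd_same //; lia.
    * by rewrite upd_same big_ord0.
  + move=> i s3 lt_i r3 [k3 o3 a3 b3].
    have e3 := keeps_env k3 lt_vs.
    apply: (@runs_weaken _ _ _ _ (tb + (1 + (1 + (1 + 1)))));
      [|by lia|move=> s' h; exact: h].
    apply: runs_seq (IHb (rcons vs d.+1) d.+3 s3 M _ _ _) _.
    * rewrite all_rcons; apply/andP; split=> /=; first by lia.
      by apply: all_ltn_trans lt_vs; lia.
    * by case: k3 => _ ->.
    * rewrite map_rcons e3 a3 all_rcons; apply/andP; split=> /=; first by lia.
      by apply: sub_all le_m => j; lia.
    move=> s4 [k4 o4 r4]; rewrite map_rcons e3 a3 in r4.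
    apply: runs_seq; first by apply: runs_add; exact: erefl.
    move=> _ <-; apply: runs_seq; first by apply: runs_const; exact: erefl.
    move=> _ <-; apply: runs_seq; first by apply: runs_add; exact: erefl.
    move=> _ <-; apply: runs_sub.
    have [r4d r4d1 r4d2] : [/\ regs s4 d = va - i, regs s4 d.+1 = i &
        regs s4 d.+2 = regs s3 d.+2].
      by case: k4 => k4 _; split; rewrite k4; lia.
    split=> /=.
      by rewrite /upd; repeat (case: eqP => ?); lia.
    split=> /=; rewrite ?o4 //.
    * apply: (keeps_trans k3); apply: keeps_trans (keeps_leq _ k4) _; first by lia.
      do 4?[apply: keeps_trans (keeps_set_reg _ _ _); last by lia].
      exact: keeps_refl.
    * by rewrite /upd; repeat (case: eqP => ?); lia.
    * rewrite big_ord_recr /= -b3 -r4 -r4d2.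
      by rewrite /upd; repeat (case: eqP => ?); lia.
  + move=> s3 [r3 [k3 o3 a3 b3]]; apply: runs_add; split=> //=.
      exact: keeps_trans k3 (keeps_set_reg _ _ (leqnn d)).
    by rewrite upd_same b3 r3 addn0.
Qed.

Fixpoint compile (vs : seq nat) (d : nat) (p : emitter) : cmd :=
  match p with
  | Put e => Seq (compile_expr vs d e) (Emit d)
  | Then p q => Seq (compile vs d p) (compile vs d q)
  | Branch e p q =>
      Seq (compile_expr vs d e) (If d (compile vs d p) (compile vs d q))
  | Bind e p => Seq (compile_expr vs d e) (compile (rcons vs d) d.+1 p)
  | For e p =>
      Seq (compile_expr vs d e) (Seq (Const d.+1 0)
        (While d (Seq (compile (rcons vs d.+1) d.+2 p)
                 (Seq (Const d.+2 1)
                 (Seq (Add d.+1 d.+1 d.+2) (Sub d d d.+2))))))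
  end.

Fixpoint emit_time (p : emitter) (m : nat) : nat :=
  match p with
  | Put e => time_bound e m + 1
  | Then p q => emit_time p m + emit_time q m
  | Branch e p q => time_bound e m + (emit_time p m + emit_time q m + 1)
  | Bind e p => time_bound e m + emit_time p (m + val_bound e m)
  | For e p =>
      time_bound e m +
      (val_bound e m * (emit_time p (m + val_bound e m) + 4) + 2)
  end.

Lemma emit_time_poly p : poly_bounded (emit_time p).
Proof.
elim: p => [e|p IHp q IHq|e p IHp q IHq|e p IHp|e p IHp] /=;
  repeat (apply: poly_bounded_add || apply: poly_bounded_mul
          || exact: poly_bounded_const || exact: val_bound_poly
          || exact: time_bound_poly) => //.
all: apply: (@poly_bounded_comp _ (fun m => m + val_bound e m)) => //.
all: exact: poly_bounded_add poly_bounded_id (val_bound_poly e).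
Qed.

Definition emit_post x p vs d s s' : Prop :=
  keeps d s s' /\ out s' = out s ++ emitted x p (map (regs s) vs).

Lemma compileP x p vs d s m :
  all (ltn^~ d) vs -> mem s = bits x -> all (leq^~ m) (map (regs s) vs) ->
  runs (compile vs d p) s (emit_post x p vs d s) (emit_time p m).
Proof.
elim: p vs d s m => [e|p IHp q IHq|e p IHp q IHq|e p IHp|e p IHp]
  vs d s m lt_vs ms le_m /=.
- apply: runs_seq (compile_exprP e lt_vs ms le_m) _ => s1 [k1 o1 r1].
  by apply: runs_emit; split=> //=; rewrite r1 o1 cats1.
- apply: runs_seq (IHp _ _ _ _ lt_vs ms le_m) _ => s1 [k1 o1].
  have e1 := keeps_env k1 lt_vs.
  apply: (runs_weaken (IHq vs d s1 m lt_vs _ _)); rewrite ?e1 //.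
    by case: k1 => _ ->.
  move=> s2 [k2 o2]; split; first exact: keeps_trans k1 k2.
  by rewrite o2 o1 e1 catA.
- apply: runs_seq (compile_exprP e lt_vs ms le_m) _ => s1 [k1 o1 r1].
  have e1 := keeps_env k1 lt_vs; have m1 : mem s1 = bits x by case: k1 => _ ->.
  rewrite addn1 /emit_post /= -r1.
  apply: runs_if => r1b; rewrite ?r1b /=.
    apply: (runs_weaken (IHp vs d s1 m lt_vs m1 _)); rewrite ?e1 //.
    move=> s2 [k2 o2]; split; first exact: keeps_trans k1 k2.
    by rewrite o2 o1 e1.
  apply: (runs_weaken (IHq vs d s1 m lt_vs m1 _)); rewrite ?e1 //.
  move=> s2 [k2 o2]; split; first exact: keeps_trans k1 k2.
  by rewrite o2 o1 e1.
- have le_e := eval_le x e le_m.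
  apply: runs_seq (compile_exprP e lt_vs ms le_m) _ => s1 [k1 o1 r1].
  have e1 := keeps_env k1 lt_vs; have m1 : mem s1 = bits x by case: k1 => _ ->.
  apply: (runs_weaken (IHp (rcons vs d) d.+1 s1 (m + val_bound e m) _ _ _)) => //.
  + rewrite all_rcons /= ltnSn /=; exact: all_ltn_trans (leqnSn d) lt_vs.
  + rewrite map_rcons e1 r1 all_rcons; apply/andP; split=> /=; first by lia.
    by apply: sub_all le_m => j; lia.
  + move=> s2 [k2 o2]; split.
      exact: keeps_trans k1 (keeps_leq (leqnSn d) k2).
    by rewrite o2 o1 map_rcons e1 r1.
- have le_e := eval_le x e le_m.
  apply: runs_seq (compile_exprP e lt_vs ms le_m) _ => s1 [k1 o1 r1].
  rewrite /emit_post /=.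
  set ve := eval x e _ in r1 le_e *; set M := m + _; set tp := emit_time p M.
  apply: (@runs_weaken _ _ _ _ (1 + (ve * (tp + 3).+1).+1));
    [|by nia|move=> s' h; exact: h].
  apply: runs_seq; first by apply: runs_const; exact: erefl.
  move=> _ <-.
  pose I i s' := [/\ keeps d s s', regs s' d.+1 = i & out s' = out s ++
    flatten [seq emitted x p (rcons (map (regs s) vs) j) | j <- iota 0 i]].
  apply: (@runs_weaken _ _ (fun s' => regs s' d = 0 /\ I ve s') _
    (ve * (tp + 3).+1).+1) => //;
    last by move=> s' [_ []].
  apply: runs_while.
  + by rewrite /= upd_other //; lia.
  + split=> /=; rewrite ?o1 ?cats0 ?upd_same //.
    by apply: keeps_trans k1 (keeps_set_reg _ _ (leqnSn d)).
  + move=> i s3 lt_i r3 [k3 a3 o3].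
    have e3 := keeps_env k3 lt_vs.
    apply: (@runs_weaken _ _ _ _ (tp + (1 + (1 + 1))));
      [|by lia|move=> s' h; exact: h].
    apply: runs_seq (IHp (rcons vs d.+1) d.+2 s3 M _ _ _) _.
    * rewrite all_rcons; apply/andP; split=> /=; first by lia.
      by apply: all_ltn_trans lt_vs; lia.
    * by case: k3 => _ ->.
    * rewrite map_rcons e3 a3 all_rcons; apply/andP; split=> /=; first by lia.
      by apply: sub_all le_m => j; lia.
    move=> s4 [k4 o4]; rewrite map_rcons e3 a3 in o4.
    apply: runs_seq; first by apply: runs_const; exact: erefl.
    move=> _ <-; apply: runs_seq; first by apply: runs_add; exact: erefl.
    move=> _ <-; apply: runs_sub.
    have [r4d r4d1] : regs s4 d = ve - i /\ regs s4 d.+1 = i.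
      by case: k4 => k4 _; split; rewrite k4; lia.
    split=> /=.
      by rewrite /upd; repeat (case: eqP => ?); lia.
    split.
    * apply: (keeps_trans k3); apply: keeps_trans (keeps_leq _ k4) _; first by lia.
      do 3?[apply: keeps_trans (keeps_set_reg _ _ _); last by lia].
      exact: keeps_refl.
    * by rewrite /= /upd; repeat (case: eqP => ?); lia.
    * by rewrite -[i.+1]addn1 iotaD map_cat flatten_cat /= cats0 o4 o3 catA.
Qed.

(** Registers 0 and 1 are the initial environment, and the compiled code writes only from register 2
    on. Hence [k] is still in register 1 at the end, and the identity bounds the new parameter. *)
Lemma emitter_reduction (p : emitter) (P Q : pproblem) :
  (forall x k, P x k <-> Q (emitted x p [:: size x; k]) k) ->
  fpt_reducible P Q.
Proof.
move=> PQ; have [c pc] := emit_time_poly p.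
exists (compile [:: 0; 1] 2 p), (fun k => k.+2 ^ c), id, c; split.
(* For fixed [c] the factor [k.+2 ^ c] is itself an expression, so the compiler also shows it
   computable; the result is then copied from register 2 to register 1, where it is read off. *)
- pose e := iter c (Times (Plus (Var 1) (Cst 2))) (Cst 1).
  exists (Seq (compile_expr [:: 0; 1] 2 e) (Seq (Const 3 0) (Add 1 2 3))) => k.
  have [] : runs (Seq (compile_expr [:: 0; 1] 2 e) (Seq (Const 3 0) (Add 1 2 3)))
      (init [::] k) (fun s => regs s 1 = k.+2 ^ c) (time_bound e k + (1 + 1)).
    apply: runs_seq (@compile_exprP [::] e [:: 0; 1] 2 _ k _ _ _) _ => //=.
      by rewrite leqnn.
    move=> s1 [_ _ r2]; apply: runs_seq; first by apply: runs_const; exact: erefl.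
    move=> _ <-; apply: runs_add.
    rewrite /= upd_same [upd _ 3 0 3]upd_same upd_other // addn0 r2.
    by rewrite /e; elim: c {pc r2 e} => //= c IHc; rewrite IHc expnS addn2.
  by move=> s [t [ex _ rs]]; exists s, t.
- by exists Skip => k; exists (init [::] k), 1; split=> //; constructor.
- move=> x k.
  have [|s [t [ex le [[rs _] os]]]] :=
    @compileP x p [:: 0; 1] 2 (init x k) (size x + k) isT erefl.
    by rewrite /= leq_addr leq_addl.
  have r1 : regs s 1 = k by rewrite rs.
  exists s, t; split=> //; last by rewrite r1 os; exact: PQ.
    apply: leq_trans le _; apply: leq_trans (pc _) _.
    (* [size x + k + 2 <= k.+2 * (size x).+1] separates the parameter from the input length. *)
    rewrite -expnMn; case: c {pc} => // c; rewrite leq_exp2r //; nia.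
  by rewrite r1.
Qed.

(** * Circuits for binary constraints *)

(** Unary codes are prefix-free; carrying the remainders [r] and [r'] lets this pass through
    concatenations. *)
Lemma enc_nat_inj n n' r r' :
  enc_nat n ++ r = enc_nat n' ++ r' -> n = n' /\ r = r'.
Proof.
rewrite /enc_nat; elim: n n' => [|n IHn] [|n'] //=; first by case.
by case=> /IHn [-> ->].
Qed.

Lemma enc_nats_inj js js' r r' : size js = size js' ->
  flatten (map enc_nat js) ++ r = flatten (map enc_nat js') ++ r' ->
  js = js' /\ r = r'.
Proof.
elim: js js' => [|j js IHjs] [|j' js'] //= [sz].
by rewrite -!catA => /enc_nat_inj [-> /(IHjs _ sz) [-> ->]].
Qed.

Lemma enc_seq_inj js js' r r' :
  enc_seq js ++ r = enc_seq js' ++ r' -> js = js' /\ r = r'.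
Proof. by rewrite /enc_seq -!catA => /enc_nat_inj [sz /(enc_nats_inj sz)]. Qed.

Lemma enc_gate_inj g g' r r' :
  enc_gate g ++ r = enc_gate g' ++ r' -> g = g' /\ r = r'.
Proof.
case: g g' => [|j|js|js] [|j'|js'|js'] //=; rewrite ?cat0s.
- by case.
- by case=> /enc_nat_inj [-> ->].
- by case=> /enc_seq_inj [-> ->].
- by case=> /enc_seq_inj [-> ->].
Qed.

(** [wcs] asserts only that some circuit has the given code; injectivity identifies it with the
    circuit that was emitted. *)
Lemma enc_circuit_inj : injective enc_circuit.
Proof.
move=> C C' /enc_nat_inj []; elim: C C' => [|g C IHC] [|g' C'] //= [sz].
by move=> /enc_gate_inj [-> /(IHC _ sz) ->].
Qed.

Definition pairs (M : nat) : seq (nat * nat) :=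
  [seq (p, q) | p <- iota 0 M, q <- iota 0 M].

Lemma size_pairs M : size (pairs M) = M * M.
Proof. by rewrite size_allpairs !size_iota. Qed.

Lemma mem_pairs M p q : ((p, q) \in pairs M) = (p < M) && (q < M).
Proof.
apply/allpairsP/andP => [[[p' q'] /= []]|[lt_p lt_q]].
  by rewrite !mem_iota => /andP[_ lt_p] /andP[_ lt_q] [-> ->].
by exists (p, q); rewrite !mem_iota.
Qed.

(** A harmless pair gets the constant false instead of no gate, so that the positions of all gates
    are independent of [conf]. *)
Definition conflict_gate (conf : rel nat) (z : nat * nat) : gate :=
  if conf z.1 z.2 then GAnd [:: z.1; z.2] else GOr [::].

(** Pair gates have fan-in at most 2, so only the disjunction at position [M + M * M] can be large.
    The depth 3 counts a pair gate, the disjunction and the final negation. *)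
Definition conflict_circuit (M : nat) (conf : rel nat) : circuit :=
  nseq M GInput ++ map (conflict_gate conf) (pairs M) ++
  [:: GOr (iota M (M * M)); GNot (M + M * M)].

Section GateValues.

Variables (V : Type) (step : seq V -> gate -> V).

Let next vs g := rcons vs (step vs g).

Lemma gate_values_inputs (h : nat -> V) M :
  (forall vs, step vs GInput = h (size vs)) ->
  gate_values step (nseq M GInput) = mkseq h M.
Proof.
move=> step_input; elim: M => [|M IHM] //.
rewrite -addn1 nseqD /gate_values foldl_cat -/(gate_values _ _) IHM /=.
by rewrite step_input size_mkseq /mkseq addn1 -[in RHS]addn1 iotaD map_cat /= cats1.
Qed.

(** Gates that do not look at one another form a layer: each can be evaluated on the common prefix
    [vs]. *)
Lemma foldl_gates (I : eqType) (F : I -> gate) (r : seq I) vs :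
  (forall i us, i \in r -> step (vs ++ us) (F i) = step vs (F i)) ->
  foldl next vs (map F r) = vs ++ [seq step vs (F i) | i <- r].
Proof.
elim/last_ind: r => [|r i IHr] stepE; first by rewrite cats0.
rewrite !map_rcons -!cats1 foldl_cat IHr; last first.
  by move=> j us j_r; apply: stepE; rewrite mem_rcons inE j_r orbT.
by rewrite /= /next stepE ?mem_rcons ?inE ?eqxx // -cats1 catA.
Qed.

(** Value, weft and depth are all instances of [gate_values], so the layers are computed once for an
    arbitrary [step]. The second hypothesis expresses that pair gates see only the input layer. *)
Lemma last_gate_values_conflict x0 (h : nat -> V) M conf :
  (forall vs, step vs GInput = h (size vs)) ->
  (forall z us, z \in pairs M ->
     step (mkseq h M ++ us) (conflict_gate conf z) =
     step (mkseq h M) (conflict_gate conf z)) ->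
  last x0 (gate_values step (conflict_circuit M conf)) =
  let vs := mkseq h M ++
    [seq step (mkseq h M) (conflict_gate conf z) | z <- pairs M] in
  step (rcons vs (step vs (GOr (iota M (M * M))))) (GNot (M + M * M)).
Proof.
move=> step_input step_pair.
rewrite /gate_values /conflict_circuit !foldl_cat -/(gate_values _ _).
by rewrite (gate_values_inputs _ step_input) foldl_gates //= last_rcons.
Qed.

End GateValues.

Lemma nth_rcons_pairs (V : Type) x0 (a : nat -> V) (F : nat * nat -> V) M o :
  nth x0 (rcons (mkseq a M ++ map F (pairs M)) o) (M + M * M) = o.
Proof.
by rewrite nth_rcons size_cat size_mkseq size_map size_pairs ltnn eqxx.
Qed.

Lemma eval_conflict_circuit a M conf :
  eval_circuit a (conflict_circuit M conf) =
  ~~ has (fun z => conf z.1 z.2 && (a z.1 && a z.2)) (pairs M).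
Proof.
rewrite /eval_circuit (@last_gate_values_conflict _ _ _ a) //; last first.
  move=> [p q] us; rewrite mem_pairs => /andP[lt_p lt_q].
  rewrite /conflict_gate /=; case: (conf p q) => //=.
  by rewrite !nth_cat size_mkseq lt_p lt_q.
rewrite /= nth_rcons_pairs; congr (~~ _).
rewrite -[X in iota X _]addn0 iotaDl has_map.
set vs := map _ _.
rewrite (@eq_has _ _ (nth false vs)); last first.
  by move=> i /=; rewrite nth_cat size_mkseq ltnNge leq_addr /= addKn.
have -> : has (nth false vs) (iota 0 (M * M)) = has id vs.
  rewrite -[in RHS](mkseq_nth false vs) has_map size_map size_pairs.
  by apply: eq_has.
rewrite has_map; apply: eq_in_has => -[p q].
rewrite mem_pairs => /andP[lt_p lt_q] /=; rewrite /conflict_gate /=.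
by case: (conf p q) => //=; rewrite !nth_mkseq // andbT.
Qed.

Lemma bigmax_const_le (r : seq nat) (F : nat -> nat) c :
  (forall i, F i <= c) -> \max_(i <- r) F i <= c.
Proof. by move=> le_c; elim/big_ind: _ => // u v uc vc; rewrite geq_max uc. Qed.

Lemma nth_le (s : seq nat) c i : all (leq^~ c) s -> nth 0 s i <= c.
Proof.
move=> s_le; case: (ltnP i (size s)) => [lt_i|ge_i]; last by rewrite nth_default.
exact: (all_nthP 0 s_le).
Qed.

Lemma nth_mkseq0 M i : nth 0 (mkseq (fun=> 0) M) i = 0.
Proof.
by have [lt_i|ge_i] := ltnP i M; [rewrite nth_mkseq|rewrite nth_default ?size_mkseq].
Qed.

Lemma nth_mkseq0_cat M us i : i < M -> nth 0 (mkseq (fun=> 0) M ++ us) i = 0.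
Proof. by move=> lt_i; rewrite nth_cat size_mkseq lt_i nth_mkseq. Qed.

Lemma weft_conflict_circuit M conf : weft (conflict_circuit M conf) <= 1.
Proof.
rewrite /weft (@last_gate_values_conflict _ _ _ (fun=> 0)); first last.
- move=> [p q] us; rewrite mem_pairs => /andP[lt_p lt_q].
  rewrite /conflict_gate /=; case: (conf p q); rewrite /= ?big_cons !big_nil //.
  by rewrite !nth_mkseq0_cat // !nth_mkseq0.
- by move=> vs; rewrite /= big_nil.
rewrite /= big_seq1 nth_rcons_pairs add0n /large /=.
(* The disjunction contributes at most 1; all inputs and pair gates below it have weft 0. *)
apply: (@leq_trans (1 + 0)) => //; apply: leq_add; first exact: leq_b1.
apply: bigmax_const_le => i; apply: nth_le; rewrite all_cat; apply/andP; split.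
  by apply/allP => _ /mapP[j _ ->].
apply/allP => _ /mapP[z _ ->]; rewrite /conflict_gate.
by case: ifP => _ /=; rewrite ?big_cons big_nil ?nth_mkseq0.
Qed.

Lemma depth_conflict_circuit M conf : depth (conflict_circuit M conf) <= 3.
Proof.
rewrite /depth (@last_gate_values_conflict _ _ _ (fun=> 0)); first last.
- move=> [p q] us; rewrite mem_pairs => /andP[lt_p lt_q].
  rewrite /conflict_gate /=; case: (conf p q); rewrite /= ?big_cons !big_nil //.
  by rewrite !nth_mkseq0_cat // !nth_mkseq0.
- by move=> vs; rewrite /= big_nil.
rewrite /= big_seq1 nth_rcons_pairs !add1n !ltnS.
apply: bigmax_const_le => i; apply: nth_le; rewrite all_cat; apply/andP; split.
  by apply/allP => _ /mapP[j _ ->].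
apply/allP => _ /mapP[z _ ->]; rewrite /conflict_gate.
by case: ifP => _ /=; rewrite ?big_cons big_nil ?nth_mkseq0.
Qed.

Lemma size_conflict_circuit M conf :
  size (conflict_circuit M conf) = (M + M * M).+2.
Proof. by rewrite !size_cat size_nseq size_map size_pairs /= !addnS addn0. Qed.

Lemma wf_conflict_circuit M conf : wf_circuit (conflict_circuit M conf).
Proof.
rewrite /wf_circuit size_conflict_circuit; apply/andP; split=> //.
apply/allP => i; rewrite mem_iota add0n leq0n => lt_i; rewrite nth_cat size_nseq.
case: ltnP => [lt_iM|ge_iM]; first by rewrite nth_nseq lt_iM.
rewrite nth_cat size_map size_pairs; case: ltnP => [lt_iMM|ge_iMM].
  rewrite (nth_map (0, 0)) ?size_pairs //.
  have := mem_nth (0, 0) (_ : i - M < size (pairs M)); rewrite size_pairs.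
  move=> /(_ lt_iMM); case: (nth _ _ _) => p q; rewrite mem_pairs => /andP[lt_p lt_q].
  by rewrite /conflict_gate /=; case: (conf p q) => //=; rewrite andbT;
     apply/andP; split; lia.
have [->|->] : i = M + M * M \/ i = (M + M * M).+1 by lia.
  rewrite addKn subnn /=; apply/allP => j; rewrite mem_iota; lia.
by rewrite (_ : _ - _ - _ = 1) /= ?andbT; lia.
Qed.

Lemma weight_conflict_circuit a M conf :
  weight a (conflict_circuit M conf) = count a (iota 0 M).
Proof.
rewrite /weight size_conflict_circuit -addnS -addnS iotaD count_cat.
rewrite [X in _ + X](_ : _ = 0) ?addn0.
  apply: eq_in_count => i; rewrite mem_iota /= => lt_i.
  by rewrite nth_cat size_nseq lt_i nth_nseq lt_i.
apply/eqP; rewrite -leqn0 leqNgt -has_count; apply/hasPn => i.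
rewrite mem_iota add0n => /andP[ge_i lt_i].
rewrite nth_cat size_nseq ltnNge ge_i /= nth_cat size_map size_pairs.
case: ltnP => [lt_iM|ge_iM].
  by rewrite (nth_map (0, 0)) ?size_pairs // /conflict_gate; case: ifP.
have [->|->] : i = M + M * M \/ i = (M + M * M).+1 by lia.
  by rewrite addKn subnn.
by rewrite (_ : _ - _ - _ = 1) //; lia.
Qed.

Lemma wcs_conflict_circuit M conf k :
  wcs 3 3 (enc_circuit (conflict_circuit M conf)) k <->
  exists a : nat -> bool, count a (iota 0 M) = k /\
    forall p q, p < M -> q < M -> conf p q -> a p -> ~~ a q.
Proof.
split=> [[C [/enc_circuit_inj <- _ _ _ [a [wa ea]]]] | [a [wa ea]]].
  rewrite weight_conflict_circuit in wa; exists a; split=> // p q lt_p lt_q cpq ap.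
  move: ea; rewrite eval_conflict_circuit => /hasPn /(_ (p, q)).
  by rewrite mem_pairs lt_p lt_q cpq ap; apply.
exists (conflict_circuit M conf); split=> //.
- exact: wf_conflict_circuit.
- exact: leq_trans (weft_conflict_circuit _ _) _.
- exact: depth_conflict_circuit.
exists a; rewrite weight_conflict_circuit eval_conflict_circuit; split=> //.
apply/hasPn => -[p q]; rewrite mem_pairs => /andP[lt_p lt_q] /=.
by apply/and3P => -[cpq ap aq]; have := ea p q lt_p lt_q cpq ap; rewrite aq.
Qed.

(** Every circuit code begins with a nonempty unary number, which makes the empty word a no-instance
    to which malformed inputs can be sent. *)
Lemma wcs_nil t d k : ~ wcs t d [::] k.
Proof. by move=> [C [+ _ _ _ _]]; rewrite /enc_circuit /enc_nat; case: (size C). Qed.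

(** * Footprint sequences *)

(* The i-th element of the sequence is f i, and g i witnesses that P (f i) is
   not covered by the Q (f j) with j < i. *)
Definition footprint_sequence (S T k : nat) (P Q : rel nat) : Prop :=
  exists (f : 'I_k -> 'I_S) (g : 'I_k -> 'I_T),
    (forall i, P (f i) (g i)) /\
    (forall i j : 'I_k, i < j -> f i != f j /\ ~~ Q (f i) (g j)).

(* Input number (i * S + u) * T + w states that the i-th element of the
   sequence is u and that w witnesses its footprint. *)
Definition conflict (S T : nat) (P Q : rel nat) : rel nat := fun p q =>
  [|| ~~ P (p %/ T %% S) (p %% T),
      (p %/ T %/ S == q %/ T %/ S) && (p != q) |
      (p %/ T %/ S < q %/ T %/ S) &&
      ((p %/ T %% S == q %/ T %% S) || Q (p %/ T %% S) (q %% T))].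

Section Code.

Variables (S T : nat).

Let code i u w := (i * S + u) * T + w.

Lemma codeK i u w : u < S -> w < T ->
  [/\ code i u w %/ T %/ S = i, code i u w %/ T %% S = u &
      code i u w %% T = w].
Proof.
move=> lt_u lt_w; rewrite /code.
rewrite divnMDl ?(leq_ltn_trans _ lt_w) // (divn_small lt_w) addn0.
rewrite divnMDl ?(leq_ltn_trans _ lt_u) // (divn_small lt_u) addn0.
by rewrite modnMDl modn_small // modnMDl modn_small.
Qed.

Lemma code_lt k i u w : i < k -> u < S -> w < T -> code i u w < k * S * T.
Proof.
move=> lt_i lt_u lt_w; rewrite /code.
have : i * S + u < k * S by nia.
by nia.
Qed.

Lemma decode_lt k p : p < k * S * T ->
  [/\ p %/ T %/ S < k, p %/ T %% S < S & p %% T < T].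
Proof.
move=> lt_p.
have T0 : 0 < T by case: T lt_p => [|//]; rewrite muln0.
have S0 : 0 < S by case: S lt_p => [|//]; rewrite muln0.
by rewrite !ltn_divLR // !ltn_mod.
Qed.

End Code.

(** A sequence becomes the indicator of its codes. Conversely, the second clause of [conflict]
    allows at most one true input per position, the weight [k] makes it exactly one, and [f] and [g]
    are read off from its digits. *)
Lemma footprint_sequence_conflict S T k P Q :
  footprint_sequence S T k P Q <->
  exists a : nat -> bool, count a (iota 0 (k * S * T)) = k /\
    forall p q, p < k * S * T -> q < k * S * T -> conflict S T P Q p q ->
      a p -> ~~ a q.
Proof.
set M := k * S * T; split=> [[f [g [fP fQ]]]|[a [wa ea]]].
  pose c (i : 'I_k) := (i * S + f i) * T + g i.
  have cK (i : 'I_k) := codeK i (ltn_ord (f i)) (ltn_ord (g i)).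
  have c_inj : injective c.
    move=> i j eq_c; apply: val_inj; have [ci _ _] := cK i; have [cj _ _] := cK j.
    by rewrite -/(c i) eq_c in ci; rewrite /= -ci -[RHS]cj.
  exists (fun p => [exists i, p == c i]); split.
    rewrite -size_filter -[RHS](card_ord k) cardE -(size_map c).
    apply/perm_size/uniq_perm; first by rewrite filter_uniq ?iota_uniq.
      by rewrite map_inj_uniq ?enum_uniq.
    move=> p; rewrite mem_filter mem_iota /= add0n.
    apply/andP/mapP => [[/existsP[i /eqP ->] _]|[i _ ->]].
      by exists i; rewrite ?mem_enum.
    by split; [apply/existsP; exists i | exact: code_lt].
  move=> p q _ _ cpq /existsP[i /eqP pE]; apply/existsP => -[j /eqP qE].
  have [i1 u1 w1] := cK i; have [j1 u2 w2] := cK j.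
  move: cpq; rewrite /conflict pE qE /c i1 u1 w1 j1 u2 w2 fP /=.
  case/orP => [/andP[/eqP ij /negP[]]|/andP[lt_ij]].
    by rewrite (val_inj ij).
  have [ne nQ] := fQ _ _ lt_ij.
  by rewrite (negPf nQ) orbF => /eqP fij; case/eqP: ne; apply: val_inj.
pose ts := [seq p <- iota 0 M | a p]; pose lev p := p %/ T %/ S.
have tsP p : p \in ts -> a p /\ p < M.
  by rewrite mem_filter mem_iota add0n /= => /andP[].
have lev_inj : {in ts &, injective lev}.
  move=> p q /tsP[ap lt_p] /tsP[aq lt_q] pq; apply/eqP; apply/negPn/negP => ne.
  have /negP[] // : ~~ a q; apply: (ea p) => //.
  by rewrite /conflict -!/(lev _) pq eqxx ne orbT.
(* Pigeonhole: [k] true inputs with distinct positions below [k] occupy all of them. *)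
have lev_all : map lev ts =i iota 0 k.
  have [] // := @uniq_min_size _ (map lev ts) (iota 0 k).
  - by rewrite map_inj_in_uniq // filter_uniq ?iota_uniq.
  - move=> _ /mapP[p /tsP[_ /decode_lt[lt_p _ _]] ->].
    by rewrite mem_iota.
  - by rewrite size_map size_filter wa size_iota.
have [h hP] : exists h : 'I_k -> nat, forall i, h i \in ts /\ lev (h i) = i.
  apply: (@fin_all_exists 'I_k (fun=> nat) (fun i p => p \in ts /\ lev p = i)) => i.
  have : (i : nat) \in map lev ts by rewrite lev_all mem_iota /=.
  by case/mapP => p p_ts ->; exists p.
have hu i : h i %/ T %% S < S.
  by have [/tsP[_ /decode_lt[]]] := hP i.
have hw i : h i %% T < T.
  by have [/tsP[_ /decode_lt[]]] := hP i.
exists (fun i => Ordinal (hu i)), (fun i => Ordinal (hw i)); split=> [i|i j lt_ij] /=.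
  (* The first clause of [conflict] concerns [p] alone, so an input without a valid witness
     conflicts with itself. *)
  have [/tsP[ai lt_i] _] := hP i; apply/negPn/negP => nP.
  by have /negP[] : ~~ a (h i) by apply: (ea (h i)) => //; rewrite /conflict nP.
have [/tsP[ai lt_i] li] := hP i; have [/tsP[aj lt_j] lj] := hP j.
have nc : ~~ conflict S T P Q (h i) (h j).
  by apply/negP => c; have := ea _ _ lt_i lt_j c ai; rewrite aj.
move: nc; rewrite /conflict -!/(lev _) li lj lt_ij /= !negb_or.
by case/and4P => _ _ ne nQ; rewrite -val_eqE.
Qed.

Section Footprinting.

Variables (S T : nat) (X : finType) (D : {pred X}) (e : 'I_S -> X).
Variables (P' Q' : X -> {set 'I_T}) (P Q : rel nat).
Hypothesis PE : forall (u : 'I_S) (w : 'I_T), P u w = (e u \in D) && (w \in P' (e u)).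
Hypothesis QE : forall (u : 'I_S) (w : 'I_T), Q u w = (w \in Q' (e u)).

(** [e] is the identity for graphs and the lookup in the list of edges for hypergraphs; [D] carries
    the restriction to one side or to the edges. The sequence is truncated to its first [k]
    elements, where fewer sets precede each element and nothing else changes. *)
Lemma footprint_of_footprinting k m (s : m.-tuple X) :
  (forall x, x \in D -> exists u, e u = x) ->
  k <= m -> uniq s -> {subset s <= D} -> footprinting P' Q' s ->
  footprint_sequence S T k P Q.
Proof.
move=> e_onto le_km s_uniq sD fp.
have [f fE] : exists f : 'I_m -> 'I_S, forall i, e (f i) = tnth s i.
  apply: (@fin_all_exists 'I_m (fun=> 'I_S) (fun i u => e u = tnth s i)) => i.
  by apply: e_onto; apply: sD; apply: mem_tnth.
have [g gE] : exists g : 'I_m -> 'I_T, forall i,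
    g i \in P' (tnth s i) :\: \bigcup_(j < m | j < i) Q' (tnth s j).
  apply: (@fin_all_exists 'I_m (fun=> 'I_T) (fun i w => w \in P' (tnth s i) :\:
    \bigcup_(j < m | j < i) Q' (tnth s j))) => i.
  by have /set0Pn[w w_in] := fp i; exists w.
exists (f \o widen_ord le_km), (g \o widen_ord le_km); split=> [i|i j lt_ij] /=.
  rewrite PE fE sD ?mem_tnth //=.
  by have := gE (widen_ord le_km i); rewrite inE => /andP[].
split.
  apply/eqP => eq_f; have /tuple_uniqP s_inj := s_uniq.
  have : tnth s (widen_ord le_km i) = tnth s (widen_ord le_km j).
    by rewrite -!fE eq_f.
  by move=> /s_inj /(congr1 val) /= ij; rewrite ij ltnn in lt_ij.
rewrite QE fE; have := gE (widen_ord le_km j); rewrite inE => /andP[+ _].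
by apply: contra => w_in; apply/bigcupP; exists (widen_ord le_km i).
Qed.

(** An edge may be listed several times, so distinct indices give distinct objects only for
    injective [e]; covering sequences do not ask for distinctness. *)
Lemma footprinting_of_footprint k :
  footprint_sequence S T k P Q ->
  exists s : k.-tuple X, [/\ injective e -> uniq s, {subset s <= D} &
    footprinting P' Q' s].
Proof.
move=> [f [g [fP fQ]]]; exists [tuple e (f i) | i < k]; split.
- move=> e_inj; apply/tuple_uniqP => i j; rewrite !tnth_mktuple => /e_inj eq_f.
  case: (ltngtP i j) => [/fQ[/eqP//]|/fQ[/eqP/(_ (esym eq_f))//]|/val_inj //].
- move=> _ /mapP[i _ ->]; by have := fP i; rewrite PE => /andP[].
- move=> i; apply/set0Pn; exists (g i); rewrite inE tnth_mktuple.
  have := fP i; rewrite PE => /andP[_ ->]; rewrite andbT.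
  apply/bigcupP => -[j lt_ji]; rewrite tnth_mktuple -QE.
  by have [_ /negP] := fQ _ _ lt_ji.
Qed.

End Footprinting.

(** * Decoding *)

Definition entry (x : word) (o n u v : nat) : bool := nth false x (o + (u * n + v)).

Lemma index_enc_nat n y : index false (enc_nat n ++ y) = n.
Proof. by elim: n => //= n ->. Qed.

(** The leading block of ones is a unary header as soon as a terminating [false] occurs, which is
    what the hypothesis says. *)
Lemma enc_natK x : index false x < size x ->
  x = enc_nat (index false x) ++ drop (index false x).+1 x.
Proof. by elim: x => //= -[] x IHx //=; [rewrite ltnS => /IHx {1}->|rewrite drop0]. Qed.

Lemma size_enc_nat n : size (enc_nat n) = n.+1.
Proof. by rewrite size_rcons size_nseq. Qed.

Lemma nth_enc_nat n y i : nth false (enc_nat n ++ y) (n.+1 + i) = nth false y i.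
Proof. by rewrite nth_cat size_enc_nat ltnNge leq_addr addKn. Qed.

Lemma size_flatten_rows n (rows : seq word) :
  all (fun r => size r == n) rows -> size (flatten rows) = size rows * n.
Proof. by elim: rows => //= r rows IH /andP[/eqP sr /IH]; rewrite size_cat sr => ->. Qed.

Lemma nth_flatten_rows n (rows : seq word) u v :
  all (fun r => size r == n) rows -> v < n ->
  nth false (flatten rows) (u * n + v) = nth false (nth [::] rows u) v.
Proof.
move=> + lt_v; elim: rows u => [|r rows IH] u /=; first by rewrite !nth_nil.
move=> /andP[/eqP sr /IH {}IH]; rewrite nth_cat sr; case: u => [|u] /=.
  by rewrite lt_v.
by rewrite mulSn -addnA ltnNge leq_addr addKn IH.
Qed.

(** The shape shared by adjacency matrices and lists of edges, so that both are decoded by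
    [matrix_wordK]. *)
Definition matrix_word m n (F : 'I_m -> 'I_n -> bool) : word :=
  flatten [seq [seq F u v | v <- enum 'I_n] | u <- enum 'I_m].

Lemma matrix_word_rows m n (F : 'I_m -> 'I_n -> bool) :
  all (fun r => size r == n) [seq [seq F u v | v <- enum 'I_n] | u <- enum 'I_m].
Proof. by apply/allP => _ /mapP[u _ ->]; rewrite size_map size_enum_ord. Qed.

Lemma size_matrix_word m n (F : 'I_m -> 'I_n -> bool) :
  size (matrix_word F) = m * n.
Proof.
by rewrite (size_flatten_rows (matrix_word_rows F)) size_map size_enum_ord.
Qed.

Lemma nth_matrix_word m n (F : 'I_m -> 'I_n -> bool) (u : 'I_m) (v : 'I_n) :
  nth false (matrix_word F) (u * n + v) = F u v.
Proof.
rewrite (nth_flatten_rows _ (matrix_word_rows F)) //.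
rewrite (nth_map u) ?size_enum_ord // (nth_map v) ?size_enum_ord //.
by rewrite !nth_ord_enum.
Qed.

Lemma matrix_wordK m n (y : word) : size y = m * n ->
  matrix_word (fun (u : 'I_m) (v : 'I_n) => nth false y (u * n + v)) = y.
Proof.
move=> sy; apply: (@eq_from_nth _ false); rewrite size_matrix_word // => i lt_i.
have n0 : 0 < n by case: n lt_i {sy} => [|//]; rewrite muln0.
have lt_u : i %/ n < m by rewrite ltn_divLR.
have lt_v : i %% n < n by rewrite ltn_mod.
by rewrite (divn_eq i n) (nth_matrix_word _ (Ordinal lt_u) (Ordinal lt_v)).
Qed.

Lemma enc_graphE (G : graph) :
  enc_graph G = enc_nat (order G) ++ matrix_word (@adj G).
Proof. by []. Qed.

Lemma enc_graph_entry (G : graph) y (u v : vertex G) :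
  entry (enc_graph G ++ y) (order G).+1 (order G) u v = adj u v.
Proof.
rewrite /entry enc_graphE -catA nth_enc_nat nth_cat size_matrix_word.
have -> : u * order G + v < order G * order G.
  by move: (ltn_ord u) (ltn_ord v); nia.
by rewrite nth_matrix_word.
Qed.

Lemma size_enc_graph (G : graph) :
  size (enc_graph G) = (order G).+1 + order G * order G.
Proof. by rewrite enc_graphE size_cat size_enc_nat size_matrix_word. Qed.

Lemma index_enc_graph (G : graph) y : index false (enc_graph G ++ y) = order G.
Proof. by rewrite enc_graphE -catA index_enc_nat. Qed.

Definition graph_matrix (x : word) : Prop :=
  let n := index false x in forall u v, u < n -> v < n ->
    ~~ entry x n.+1 n u u /\ entry x n.+1 n u v = entry x n.+1 n v u.

Lemma graph_matrix_enc_graph (G : graph) y : graph_matrix (enc_graph G ++ y).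
Proof.
rewrite /graph_matrix /= index_enc_graph => u v lt_u lt_v.
rewrite !(enc_graph_entry y (Ordinal lt_u) (Ordinal lt_u)).
rewrite (enc_graph_entry y (Ordinal lt_u) (Ordinal lt_v)).
rewrite (enc_graph_entry y (Ordinal lt_v) (Ordinal lt_u)).
by rewrite adj_irr adj_sym.
Qed.

(** Length, symmetry and irreflexivity characterise codes of graphs, so a program can test for them.
    The remainder leaves room for the side vector of the one-sided problem. *)
Lemma enc_graphK (x : word) : let n := index false x in
  n.+1 + n * n <= size x -> graph_matrix x ->
  exists G : graph, x = enc_graph G ++ drop (n.+1 + n * n) x.
Proof.
move=> n sx gx.
pose a (u v : 'I_n) := entry x n.+1 n u v.
have a_sym : symmetric a.
  by move=> u v; have [_] := gx u v (ltn_ord u) (ltn_ord v).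
have a_irr : irreflexive a.
  by move=> u; apply: negbTE; have [] := gx u u (ltn_ord u) (ltn_ord u).
exists (Graph a_sym a_irr); rewrite enc_graphE /= -/n.
have lt_n : n < size x by lia.
rewrite {1}(enc_natK lt_n) -/n -catA; congr (_ ++ _).
rewrite -{1}(cat_take_drop (n * n) (drop n.+1 x)) drop_drop addnC; congr (_ ++ _).
rewrite -[LHS](@matrix_wordK n n); last by rewrite size_takel // size_drop; lia.
rewrite /matrix_word; congr flatten; apply: eq_map => u; apply: eq_map => v.
rewrite nth_take ?nth_drop //.
by move: (ltn_ord u) (ltn_ord v); nia.
Qed.

(** * The problems as footprint sequences *)

Definition nbhd (c : bool) (G : graph) (v : vertex G) : {set vertex G} :=
  if c then cln v else opn v.

Definition nbhd_entry (c : bool) (x : word) (u w : nat) : bool :=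
  entry x (index false x).+1 (index false x) u w || c && (u == w).

Lemma nbhd_entryE c (G : graph) y (u w : vertex G) :
  nbhd_entry c (enc_graph G ++ y) u w = (w \in nbhd c u).
Proof.
rewrite /nbhd_entry index_enc_graph enc_graph_entry /nbhd.
by case: c; rewrite !inE ?orbF // orbC eq_sym.
Qed.

(** Choosing closed or open neighborhoods for each of the two roles yields four graph problems at
    once. The condition on the word is split off because the program tests it, while the circuit
    takes care of the sequence. *)
Lemma graph_problemP cp cq x k :
  (exists G : graph, x = enc_graph G /\
     exists m (s : m.-tuple (vertex G)), k <= m /\
       (uniq s /\ footprinting (@nbhd cp G) (@nbhd cq G) s)) <->
  let n := index false x in
  [/\ size x = n.+1 + n * n, graph_matrix x &
      footprint_sequence n n k (nbhd_entry cp x) (nbhd_entry cq x)].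
Proof.
split=> [[G [-> [m [s [le_km [s_uniq fp]]]]]] | /= [sx gx fs]].
  rewrite -[enc_graph G]cats0 index_enc_graph; split.
  - by rewrite cats0 size_enc_graph.
  - exact: graph_matrix_enc_graph.
  apply: (@footprint_of_footprinting _ _ _ predT id (@nbhd cp G) (@nbhd cq G)
    _ _ _ _ k m s) => //.
  - by move=> u w; rewrite nbhd_entryE.
  - by move=> u w; rewrite nbhd_entryE.
  - by move=> v _; exists v.
have [G xG] := enc_graphK (eq_leq (esym sx)) gx.
rewrite drop_oversize ?sx // in xG.
move: fs; rewrite xG index_enc_graph => fs.
have [||s [s_uniq _ fp]] := @footprinting_of_footprint _ _ _ predT id (@nbhd cp G)
  (@nbhd cq G) _ _ _ _ k fs.
- by move=> u w; rewrite nbhd_entryE.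
- by move=> u w; rewrite nbhd_entryE.
exists G; split; first by rewrite cats0.
by exists k, s; split=> //; split=> //; apply: s_uniq.
Qed.

Definition side (x : word) (u : nat) : bool :=
  let n := index false x in nth false x (n.+1 + n * n + u).

Lemma side_enc (G : graph) (A : {set vertex G}) (u : vertex G) :
  side (enc_graph G ++ enc_set A) u = (u \in A).
Proof.
rewrite /side index_enc_graph -size_enc_graph nth_cat ltnNge leq_addr addKn /=.
by rewrite (nth_map u) ?size_enum_ord // nth_ord_enum.
Qed.

(** [B] can only be the complement of [A], so a bipartition just means that every edge changes
    [side]; the restriction of the sequence to [A] is moved into the first relation. *)
Lemma one_sidedP x k :
  one_sided_grundy_total_domination x k <->
  let n := index false x in
  [/\ size x = n.+1 + n * n + n, graph_matrix x,
      forall u v, u < n -> v < n -> entry x n.+1 n u v -> side x u != side x v &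
      footprint_sequence n n k (fun u w => side x u && nbhd_entry false x u w)
        (nbhd_entry false x)].
Proof.
split=> [[G [A [B [-> [AB dAB bip] [s [[s_uniq fp] sA]]]]]] | /= [sx gx bip fs]].
  have BE v : (v \in B) = (v \notin A).
    have := in_setT v; rewrite -AB inE; have := disjointFr dAB (_ : v \in A).
    by case: (v \in A) => [/(_ isT) -> //|_ /= ->].
  rewrite index_enc_graph; split.
  - by rewrite size_cat size_enc_graph size_map size_enum_ord.
  - exact: graph_matrix_enc_graph.
  - move=> u v lt_u lt_v.
    rewrite (enc_graph_entry _ (Ordinal lt_u) (Ordinal lt_v)) => /bip.
    rewrite (side_enc A (Ordinal lt_u)) (side_enc A (Ordinal lt_v)) BE => ->.
    by case: (_ \in A).
  apply: (@footprint_of_footprinting _ _ _ A id (@opn G) (@opn G)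
    _ _ _ _ k k s) => //.
  - by move=> u w; rewrite side_enc nbhd_entryE.
  - by move=> u w; rewrite nbhd_entryE.
  - by move=> v _; exists v.
have [|G xG] := enc_graphK _ gx; first by rewrite sx leq_addr.
move: sx bip fs xG; set y := drop _ x; set n := index false x => sx bip fs xG.
have nG : n = order G by rewrite /n xG index_enc_graph.
have sy : size y = order G by rewrite size_drop sx addKn.
pose A := [set u : vertex G | nth false y u].
have yA : y = enc_set A.
  apply: (@eq_from_nth _ false) => [|i lt_i]; first by rewrite size_map size_enum_ord.
  rewrite sy in lt_i; rewrite (nth_map (Ordinal lt_i)) ?size_enum_ord //.
  by rewrite (nth_ord_enum _ (Ordinal lt_i)) inE.
rewrite yA in xG; rewrite xG nG in bip fs.
have [||s [s_uniq sA fp]] := @footprinting_of_footprint _ _ _ A id (@opn G)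
  (@opn G) _ _ _ _ k fs.
- by move=> u w; rewrite side_enc nbhd_entryE.
- by move=> u w; rewrite nbhd_entryE.
exists G, A, (~: A); split=> //.
  split; first by rewrite setUCr.
    by rewrite -setI_eq0 setICr.
  move=> u v uv; have := bip u v (ltn_ord u) (ltn_ord v).
  rewrite enc_graph_entry uv !side_enc in_setC => /(_ isT).
  by case: (u \in A); case: (v \in A).
by exists s; split=> //; split=> //; apply: s_uniq.
Qed.

Definition edge_count (x : word) : nat :=
  index false (drop (index false x).+1 x).

Definition edge_entry (x : word) : rel nat :=
  entry x ((index false x).+1 + (edge_count x).+1) (index false x).

Lemma enc_set_rows n (Es : seq {set 'I_n}) :
  all (fun r => size r == n) (map (@enc_set n) Es).
Proof. by apply/allP => _ /mapP[C _ ->]; rewrite size_map size_enum_ord. Qed.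

Lemma index_enc_hypergraph n (Es : seq {set 'I_n}) :
  index false (enc_hypergraph Es) = n.
Proof. exact: index_enc_nat. Qed.

Lemma edge_count_enc n (Es : seq {set 'I_n}) :
  edge_count (enc_hypergraph Es) = size Es.
Proof.
rewrite /edge_count index_enc_hypergraph.
by rewrite /enc_hypergraph drop_cat size_enc_nat ltnn subnn drop0 index_enc_nat.
Qed.

Lemma edge_entryE n (Es : seq {set 'I_n}) (u : 'I_(size Es)) (w : 'I_n) :
  edge_entry (enc_hypergraph Es) u w = (w \in tnth (in_tuple Es) u).
Proof.
rewrite /edge_entry index_enc_hypergraph edge_count_enc /entry -addnA.
rewrite /enc_hypergraph !nth_enc_nat (nth_flatten_rows _ (enc_set_rows Es)) //.
by rewrite (nth_map set0) // (nth_map w) ?size_enum_ord // nth_ord_enum (tnth_nth set0).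
Qed.

(** A later copy of an element has its [P] inside the [Q] of the earlier one, so no footprint is
    left. This supplies the distinctness that the definition of covering sequences does not
    state. *)
Lemma footprinting_uniq (X T : finType) (P Q : X -> {set T}) m (s : m.-tuple X) :
  (forall x, P x \subset Q x) -> footprinting P Q s -> uniq s.
Proof.
move=> PQ fp; apply/tuple_uniqP.
have ne (i j : 'I_m) : i < j -> tnth s i <> tnth s j.
  move=> lt_ij eq_s; have /set0Pn[w] := fp j; rewrite inE => /andP[/bigcupP nw wP].
  by apply: nw; exists i => //; rewrite eq_s (subsetP (PQ _)).
move=> i j eq_s; case: (ltngtP i j) => [/ne//|/ne/(_ (esym eq_s))//|/val_inj//].
Qed.

Lemma grundy_coveringP x k :
  grundy_covering x k <->
  let n := index false x in let m := edge_count x in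
  size x = n.+1 + m.+1 + m * n /\
  footprint_sequence m n k (edge_entry x) (edge_entry x).
Proof.
split=> [[n [Es [-> [m [s [le_km [sE fp]]]]]]] | /= [sx fs]].
  rewrite index_enc_hypergraph edge_count_enc; split.
    rewrite !size_cat !size_enc_nat (size_flatten_rows (enc_set_rows Es)).
    by rewrite size_map addnA.
  apply: (@footprint_of_footprinting _ _ _ [in Es] (tnth (in_tuple Es)) id id
    _ _ _ _ k m s) => //.
  - by move=> u w; rewrite edge_entryE mem_tnth.
  - by move=> u w; rewrite edge_entryE.
  - by move=> C C_E; have /tnthP[u ->] : C \in in_tuple Es by []; exists u.
  - by apply: footprinting_uniq fp => C.
  - by move=> C /sE; rewrite inE.
move: sx fs; set n := index false x; set m := edge_count x => sx fs.
pose y := drop (n.+1 + m.+1) x.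
have sy : size y = m * n by rewrite size_drop sx addKn.
pose Es := [seq [set v : 'I_n | nth false y (u * n + v)] | u : 'I_m <- enum 'I_m].
have xE : x = enc_hypergraph Es.
  have lt_n : n < size x by lia.
  rewrite {1}(enc_natK lt_n) -/n /enc_hypergraph; congr (_ ++ _).
  have lt_m : m < size (drop n.+1 x) by rewrite size_drop; lia.
  rewrite {1}(enc_natK lt_m) -/(edge_count x) -/m size_map size_enum_ord; congr (_ ++ _).
  rewrite drop_drop addnC -/y -[LHS](matrix_wordK sy) /matrix_word.
  rewrite -[RHS]/(flatten (map _ (map _ _))) -[in RHS]map_comp.
  congr flatten; apply: eq_map => u /=; apply: eq_map => v; by rewrite inE.
have fs' : footprint_sequence (size Es) n k (edge_entry (enc_hypergraph Es))
    (edge_entry (enc_hypergraph Es)).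
  by rewrite -edge_count_enc -xE.
have [||s [_ sE fp]] := @footprinting_of_footprint _ _ _ [in Es]
  (tnth (in_tuple Es)) id id _ _ _ _ k fs'.
- by move=> u w; rewrite edge_entryE mem_tnth.
- by move=> u w; rewrite edge_entryE.
exists n, Es; split=> //; exists k, s; split=> //; split=> // C /sE.
by rewrite inE.
Qed.

(** * Emitting the circuit *)

(* An expression stands for the condition that its value is nonzero. *)
Definition holds (x : word) (e : expr) (env : seq nat) : bool :=
  eval x e env != 0.

Notation Or := Plus (only parsing).
Notation And := Times (only parsing).
Definition Not e := Minus (Cst 1) e.
Definition Lt a b := Minus b a.
(** With truncated subtraction the two differences add up to the distance of the values. *)
Definition Eq a b := Not (Plus (Minus a b) (Minus b a)).

Lemma holds_or x a b env : holds x (Or a b) env = holds x a env || holds x b env.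
Proof. by rewrite /holds /= addn_eq0 negb_and. Qed.

Lemma holds_and x a b env : holds x (And a b) env = holds x a env && holds x b env.
Proof. by rewrite /holds /= muln_eq0 negb_or. Qed.

Lemma holds_not x a env : holds x (Not a) env = ~~ holds x a env.
Proof. by rewrite /holds /=; case: (eval _ _ _). Qed.

Lemma holds_lt x a b env : holds x (Lt a b) env = (eval x a env < eval x b env).
Proof. by rewrite /holds /= subn_eq0 ltnNge. Qed.

Lemma holds_eq x a b env : holds x (Eq a b) env = (eval x a env == eval x b env).
Proof. by rewrite holds_not /holds /= negbK addn_eq0 !subn_eq0 eqn_leq. Qed.

Lemma holds_bit x a env : holds x (Bit a) env = nth false x (eval x a env).
Proof. by rewrite /holds /=; case: nth. Qed.

Lemma holds_sum x a b env :
  holds x (Sum a b) env =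
  has (fun i => holds x b (rcons env i)) (iota 0 (eval x a env)).
Proof.
rewrite /holds /= -(big_mkord xpredT (fun i => eval x b (rcons env i))).
rewrite sum_nat_seq_neq0 /index_iota subn0.
by apply: eq_has => i; rewrite andTb.
Qed.

Definition holdsE :=
  (holds_or, holds_and, holds_not, holds_lt, holds_eq, holds_bit, holds_sum).

Lemma sum_ltn n c : \sum_(i < n) (i < c) = minn c n.
Proof.
elim: n => [|n IHn]; first by rewrite big_ord0 minn0.
by rewrite big_ord_recr /= IHn; lia.
Qed.

(* Quotients, counting the multiples of b up to a; d is the number of variables
   in scope. *)
Definition Div d a b := Sum a (Not (Minus (Times (Plus (Var d) (Cst 1)) b) a)).

(** The summand is 1 exactly when [(i + 1) * T <= p], that is when [i < p %/ T], and the quotient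
    does not exceed the range [p]. *)
Lemma sum_divn p T : 0 < T ->
  \sum_(i < p) (1 - ((i + 1) * T - p)) = p %/ T.
Proof.
move=> T0; transitivity (\sum_(i < p) (i < p %/ T)).
  apply: eq_bigr => i _; rewrite addn1.
  by have := leq_divRL i.+1 p T0; case: (leqP (i.+1 * T) p) => h ->; lia.
by rewrite sum_ltn; apply/minn_idPl; exact: leq_div.
Qed.

(* The number of ones that follow position a of the input. *)
Definition Ones d a :=
  Sum (Var 0) (Not (Sum (Plus (Var d) (Cst 1)) (Not (Bit (Plus a (Var d.+1)))))).

(** The inner sum counts zeros among the [i + 1] bits from position [o], so the summand is 1 exactly
    while only ones have been met. *)
Lemma sum_ones x o :
  \sum_(i < size x) (1 - \sum_(j < i + 1) (1 - nth false x (o + j))) =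
  index false (drop o x).
Proof.
set c := index _ _; transitivity (\sum_(i < size x) (i < c)); last first.
  rewrite sum_ltn; apply/minn_idPl; apply: leq_trans (index_size _ _) _.
  by rewrite size_drop leq_subr.
apply: eq_bigr => i _; rewrite addn1; case: ltnP => [lt_ic|le_ci].
  rewrite big1 // => j _; rewrite -nth_drop.
  have /(before_find false) /= : j < c by apply: leq_ltn_trans lt_ic; rewrite -ltnS.
  by rewrite eqbF_neg => /negbFE ->.
have lt_ci : c < i.+1 by rewrite ltnS.
rewrite (bigD1 (Ordinal lt_ci)) //= -nth_drop.
(* If no zero occurs, [c] lies past the end, where the default [false] acts as the terminator. *)
have -> : nth false (drop o x) c = false; last by [].
case: (ltnP c (size (drop o x))) => [|ge]; last by rewrite nth_default.
by rewrite /c index_mem => /nth_index ->.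
Qed.

Lemma emitted_bind x e p env :
  emitted x (Bind e p) env = emitted x p (rcons env (eval x e env)).
Proof. by []. Qed.

Lemma emitted_for x e p env :
  emitted x (For e p) env =
  flatten [seq emitted x p (rcons env i) | i <- iota 0 (eval x e env)].
Proof. by []. Qed.

Lemma emitted_then x p q env :
  emitted x (Then p q) env = emitted x p env ++ emitted x q env.
Proof. by []. Qed.

Lemma emitted_branch x e p q env :
  emitted x (Branch e p q) env =
  if holds x e env then emitted x p env else emitted x q env.
Proof. by []. Qed.

Definition put2 (b1 b2 : bool) := Then (Put (Cst b1)) (Put (Cst b2)).
Definition unary e := Then (For e (Put (Cst 1))) (Put (Cst 0)).

Lemma emitted_put2 x b1 b2 env : emitted x (put2 b1 b2) env = [:: b1; b2].
Proof. by case: b1 b2 => [] []. Qed.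

Lemma emitted_unary x e env : emitted x (unary e) env = enc_nat (eval x e env).
Proof.
rewrite /= /enc_nat -cats1; congr (_ ++ _).
by rewrite -{2}(size_iota 0 (eval x e env)); elim: (iota _ _) => //= _ s ->.
Qed.

(* The variables are 0: length of the input, 1: k, 2: T, 3: S, 4: number of
   inputs M, 5: p, 6: q, 7: p / T, 8: p / T / S, 9: q / T, 10: q / T / S. *)
Definition conflict_expr (P Q : expr -> expr -> expr) : expr :=
  let u := Minus (Var 7) (Times (Var 8) (Var 3)) in
  let w := Minus (Var 5) (Times (Var 7) (Var 2)) in
  let u' := Minus (Var 9) (Times (Var 10) (Var 3)) in
  let w' := Minus (Var 6) (Times (Var 9) (Var 2)) in
  Or (Not (P u w))
    (Or (And (Eq (Var 8) (Var 10)) (Not (Eq (Var 5) (Var 6))))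
        (And (Lt (Var 8) (Var 10)) (Or (Eq u u') (Q u w')))).

(** The first argument of each [Div] is the number of variables in scope there; the four quotients
    thereby become variables 7 to 10, from which [conflict_expr] recovers remainders by
    subtraction. *)
Definition gate_emitter (P Q : expr -> expr -> expr) : emitter :=
  Bind (Div 7 (Var 5) (Var 2)) (Bind (Div 8 (Var 7) (Var 3))
  (Bind (Div 9 (Var 6) (Var 2)) (Bind (Div 10 (Var 9) (Var 3))
  (Branch (conflict_expr P Q)
    (Then (put2 true false)
    (Then (unary (Cst 2)) (Then (unary (Var 5)) (unary (Var 6)))))
    (Then (put2 true true) (unary (Cst 0))))))).

Definition circuit_emitter (P Q : expr -> expr -> expr) : emitter :=
  let M := Var 4 in let MM := Times M M in
  Bind (Times (Times (Var 1) (Var 3)) (Var 2))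
  (Then (unary (Plus (Plus M MM) (Cst 2)))
  (Then (For M (put2 false false))
  (Then (For M (For M (gate_emitter P Q)))
  (Then (Then (put2 true true)
         (Then (unary MM) (For MM (unary (Plus M (Var 5))))))
        (Then (put2 false true) (unary (Plus M MM))))))).

Lemma flatten_map_pairs (F : nat * nat -> word) n :
  flatten (map F (pairs n)) =
  flatten [seq flatten [seq F (p, q) | q <- iota 0 n] | p <- iota 0 n].
Proof.
rewrite /pairs; elim: {2 4}(iota 0 n) => [|p s IHs] //=.
by rewrite map_cat flatten_cat IHs -map_comp.
Qed.

Section Emission.

Variables (x : word) (k S T : nat) (P Q : expr -> expr -> expr) (Pb Qb : rel nat).
Hypothesis PE : forall env u w,
  holds x (P u w) [:: size x, k, T, S & env] =
  Pb (eval x u [:: size x, k, T, S & env]) (eval x w [:: size x, k, T, S & env]).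
Hypothesis QE : forall env u w,
  holds x (Q u w) [:: size x, k, T, S & env] =
  Qb (eval x u [:: size x, k, T, S & env]) (eval x w [:: size x, k, T, S & env]).

Let M := k * S * T.

Lemma emitted_gate p q : p < M -> q < M ->
  emitted x (gate_emitter P Q) [:: size x; k; T; S; M; p; q] =
  enc_gate (conflict_gate (conflict S T Pb Qb) (p, q)).
Proof.
move=> lt_p lt_q.
have T0 : 0 < T by move: lt_p; rewrite /M; case: T => [|//]; rewrite muln0.
have S0 : 0 < S by move: lt_p; rewrite /M; case: S => [|//]; rewrite muln0.
pose env := [:: size x; k; T; S; M; p; q; p %/ T; p %/ T %/ S; q %/ T; q %/ T %/ S].
transitivity (emitted x (Branch (conflict_expr P Q)
    (Then (put2 true false)
    (Then (unary (Cst 2)) (Then (unary (Var 5)) (unary (Var 6)))))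
    (Then (put2 true true) (unary (Cst 0)))) env).
  (* Read backwards, [sum_divn] turns the quotients into the sums to which the four bindings
     evaluate; the two sides then agree by computation. *)
  by rewrite /env -!(sum_divn _ T0) -!(sum_divn _ S0).
rewrite emitted_branch !(emitted_then _ (put2 _ _)) !emitted_put2.
rewrite !(emitted_then _ (unary _)) !emitted_unary.
have -> : holds x (conflict_expr P Q) env = conflict S T Pb Qb p q.
  have mod_sub a b : a - a %/ b * b = a %% b by rewrite {1}(divn_eq a b) addKn.
  by rewrite /conflict_expr !holdsE PE QE /= !mod_sub.
rewrite /conflict_gate /=; case: (conflict _ _ _ _ _ _) => //=.
by rewrite /enc_seq /= cats0.
Qed.

Lemma emitted_circuit :
  emitted x (circuit_emitter P Q) [:: size x; k; T; S] =
  enc_circuit (conflict_circuit M (conflict S T Pb Qb)).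
Proof.
rewrite /circuit_emitter emitted_bind.
set env := rcons _ _; have {env}-> : env = [:: size x; k; T; S; M] by [].
rewrite emitted_then emitted_unary /enc_circuit size_conflict_circuit; congr (_ ++ _).
  by rewrite /= addn2.
rewrite /conflict_circuit !map_cat !flatten_cat emitted_then emitted_for; congr (_ ++ _).
  rewrite map_nseq /= -{2}(size_iota 0 M).
  by elim: (iota _ _) => //= _ s ->.
rewrite emitted_then emitted_for; congr (_ ++ _).
  rewrite -map_comp flatten_map_pairs; congr flatten; apply/eq_in_map => p.
  rewrite mem_iota add0n => lt_p; rewrite emitted_for; congr flatten.
  by apply/eq_in_map => q; rewrite mem_iota add0n => lt_q; exact: emitted_gate.
rewrite emitted_then (emitted_then _ (put2 _ _)) emitted_put2.
rewrite (emitted_then _ (unary _)) emitted_unary emitted_for.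
rewrite (emitted_then _ (put2 _ _)) emitted_put2 emitted_unary.
have E : [seq emitted x (unary (Plus (Var 4) (Var 5)))
      (rcons [:: size x; k; T; S; M] r) | r <- iota 0 (M * M)] =
    map enc_nat (iota M (M * M)).
  have -> : iota M (M * M) = map (addn M) (iota 0 (M * M)).
    by rewrite -iotaDl addn0.
  by rewrite -[RHS]map_comp; apply: eq_map => r; exact: emitted_unary.
rewrite [iota 0 _]/(iota 0 (M * M)) E.
by rewrite [flatten (map _ [:: _; _])]/= cats0 /= /enc_seq size_iota.
Qed.

End Emission.

(* Variables 2 and 3 are bound to T, the length of the unary number at the start
   of the input, and to S. *)
Definition reduction_emitter (nS valid : expr) (P Q : expr -> expr -> expr) :=
  Bind (Ones 2 (Cst 0)) (Bind nS
    (Branch valid (circuit_emitter P Q) (For (Cst 0) (Put (Cst 0))))).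

(** What is left for each problem is to write its number of objects, its validity test and its two
    relations as expressions. The tail [e] of the environment occurs because the relations are
    evaluated deep inside the loops. *)
Lemma in_W_footprint (Pi : pproblem) (nS valid : expr) (P Q : expr -> expr -> expr)
    (Sx : word -> nat) (ok : word -> Prop) (Pb Qb : word -> rel nat) :
  let env x k := [:: size x; k; index false x; Sx x] in
  (forall x k, Pi x k <-> ok x /\
     footprint_sequence (Sx x) (index false x) k (Pb x) (Qb x)) ->
  (forall x k, eval x nS [:: size x; k; index false x] = Sx x) ->
  (forall x k, reflect (ok x) (holds x valid (env x k))) ->
  (forall x k e u w, holds x (P u w) (env x k ++ e) =
     Pb x (eval x u (env x k ++ e)) (eval x w (env x k ++ e))) ->
  (forall x k e u w, holds x (Q u w) (env x k ++ e) =
     Qb x (eval x u (env x k ++ e)) (eval x w (env x k ++ e))) ->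
  in_W 3 Pi.
Proof.
move=> env PiE nSE okE PE QE; exists 3.
apply: (@emitter_reduction (reduction_emitter nS valid P Q)) => x k.
rewrite PiE /reduction_emitter 2!emitted_bind.
have -> : eval x (Ones 2 (Cst 0)) [:: size x; k] = index false x.
  by rewrite -[in RHS](drop0 x) -sum_ones.
(* On a malformed word the loop of zero rounds emits the empty word, a no-instance. *)
rewrite nSE -/(env x k) emitted_branch; case: (okE x k) => ok_x; last first.
  by split=> [[]//|/wcs_nil].
rewrite (emitted_circuit (Pb := Pb x) (Qb := Qb x) (PE x k) (QE x k)).
rewrite wcs_conflict_circuit -footprint_sequence_conflict.
by split=> [[]|].
Qed.

(** * The six problems *)

Definition Entry o u v := Bit (Plus o (Plus (Times u (Var 2)) v)).

Definition adj_start := Plus (Cst 1) (Var 2).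
Definition Adj := Entry adj_start.

Lemma holds_adj x k e u v : let n := index false x in
  let env := [:: size x, k, n & e] in
  holds x (Adj u v) env = entry x n.+1 n (eval x u env) (eval x v env).
Proof. by rewrite /= holds_bit. Qed.

Definition Nbhd (c : bool) u w := Or (Adj u w) (And (Cst c) (Eq u w)).

Lemma holds_nbhd c x k e u w : let env := [:: size x, k, index false x & e] in
  holds x (Nbhd c u w) env = nbhd_entry c x (eval x u env) (eval x w env).
Proof. by rewrite /= holds_or holds_and holds_eq holds_adj; case: c. Qed.

(** A sum acts as a bounded existential quantifier, so its negation tests a property of all pairs,
    as the validity checks require. *)
Lemma not_sum2P x v env e (n := nth 0 env v) : v < size env ->
  reflect (forall u w, u < n -> w < n -> ~~ holds x e (rcons (rcons env u) w))
    (holds x (Not (Sum (Var v) (Sum (Var v) e))) env).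
Proof.
move=> lt_v; rewrite holds_not holds_sum -all_predC.
apply: (iffP allP) => [h u w lt_u lt_w|h u].
  have /h /= : u \in iota 0 n by rewrite mem_iota.
  rewrite holds_sum -all_predC /= nth_rcons lt_v => /allP /(_ w).
  by rewrite mem_iota /=; apply.
rewrite mem_iota add0n => lt_u /=; rewrite holds_sum -all_predC /= nth_rcons lt_v.
by apply/allP => w; rewrite mem_iota add0n => lt_w; apply: h.
Qed.

Definition graph_matrix_expr :=
  Not (Sum (Var 2) (Sum (Var 2)
    (Or (Adj (Var 4) (Var 4))
        (Not (Eq (Adj (Var 4) (Var 5)) (Adj (Var 5) (Var 4))))))).

Lemma graph_matrixP x k s :
  reflect (graph_matrix x)
    (holds x graph_matrix_expr [:: size x; k; index false x; s]).
Proof.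
apply: (iffP (not_sum2P _ _ _)) => // [h n|h] u v lt_u lt_v.
  have := h u v lt_u lt_v.
  rewrite holds_or holds_not holds_eq holds_adj /= negb_or negbK.
  by case/andP => irr /eqP sym; split=> //; exact: (can_inj oddb sym).
have [irr sym] := h u v lt_u lt_v.
rewrite holds_or holds_not holds_eq holds_adj /= negb_or negbK irr /=.
by apply/eqP; congr (nat_of_bool _).
Qed.

Definition graph_size_expr := Plus adj_start (Times (Var 2) (Var 2)).

Definition graph_expr := And (Eq (Var 0) graph_size_expr) graph_matrix_expr.

Lemma in_W_graph_problem cp cq :
  in_W 3 (fun x k => exists G : graph, x = enc_graph G /\
    exists m (s : m.-tuple (vertex G)), k <= m /\
      (uniq s /\ footprinting (@nbhd cp G) (@nbhd cq G) s)).
Proof.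
pose ok x := let n := index false x in
  size x = n.+1 + n * n /\ graph_matrix x.
apply: (@in_W_footprint _ (Var 2) graph_expr (Nbhd cp) (Nbhd cq)
  (index false) ok (nbhd_entry cp) (nbhd_entry cq)) => //=.
- by move=> x k; rewrite graph_problemP /ok /=; split=> [[]|[[]]].
- move=> x k; rewrite holds_and holds_eq.
  by apply: (iffP andP) => -[/eqP sx /graph_matrixP gx].
- by move=> x k e u w; rewrite holds_nbhd.
- by move=> x k e u w; rewrite holds_nbhd.
Qed.

Definition Side u := Bit (Plus graph_size_expr u).

Lemma holds_side x k e u : let env := [:: size x, k, index false x & e] in
  holds x (Side u) env = side x (eval x u env).
Proof. by rewrite /= holds_bit. Qed.

Definition bipartite_expr :=
  Not (Sum (Var 2) (Sum (Var 2)
    (And (Adj (Var 4) (Var 5)) (Eq (Side (Var 4)) (Side (Var 5)))))).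

Lemma bipartiteP x k s (n := index false x) :
  reflect (forall u v, u < n -> v < n -> entry x n.+1 n u v -> side x u != side x v)
    (holds x bipartite_expr [:: size x; k; n; s]).
Proof.
have E u v : holds x (And (Adj (Var 4) (Var 5)) (Eq (Side (Var 4)) (Side (Var 5))))
    [:: size x; k; n; s; u; v] = entry x n.+1 n u v && (side x u == side x v).
  rewrite holds_and holds_eq holds_adj /=; congr (_ && _).
  by rewrite /side -/n /=; case: (nth _ _ _); case: (nth _ _ _).
apply: (iffP (not_sum2P _ _ _)) => // h u v lt_u lt_v.
  by move=> uv; have := h u v lt_u lt_v; rewrite /= E uv.
by rewrite /= E; apply/negP => /andP[/(h u v lt_u lt_v) /negP].
Qed.

Lemma in_W_one_sided : in_W 3 one_sided_grundy_total_domination.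
Proof.
pose ok x := let n := index false x in
  [/\ size x = n.+1 + n * n + n, graph_matrix x &
      forall u v, u < n -> v < n -> entry x n.+1 n u v -> side x u != side x v].
apply: (@in_W_footprint _ (Var 2)
  (And (Eq (Var 0) (Plus graph_size_expr (Var 2)))
       (And graph_matrix_expr bipartite_expr))
  (fun u w => And (Side u) (Nbhd false u w)) (Nbhd false)
  (index false) ok (fun x u w => side x u && nbhd_entry false x u w)
  (nbhd_entry false)) => //=.
- by move=> x k; rewrite one_sidedP /ok /=; split=> [[]|[[]]].
- move=> x k; rewrite 2!holds_and holds_eq.
  by apply: (iffP and3P) => -[/eqP sx /graph_matrixP gx /bipartiteP bx].
- by move=> x k e u w; rewrite holds_and holds_side holds_nbhd.
- by move=> x k e u w; rewrite holds_nbhd.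
Qed.

Definition edges_start := Plus adj_start (Plus (Cst 1) (Var 3)).

Lemma in_W_grundy_covering : in_W 3 grundy_covering.
Proof.
pose ok x := let n := index false x in let m := edge_count x in
  size x = n.+1 + m.+1 + m * n.
have edgeE x k e u w : let env := [:: size x; k; index false x; edge_count x] ++ e in
    holds x (Entry edges_start u w) env =
    edge_entry x (eval x u env) (eval x w env).
  by rewrite /= holds_bit.
(* The number of edges is the second unary header, right after the first one; three variables are in
   scope when it is decoded. *)
apply: (@in_W_footprint _ (Ones 3 adj_start)
  (Eq (Var 0) (Plus edges_start (Times (Var 3) (Var 2))))
  (Entry edges_start) (Entry edges_start) edge_count ok edge_entry edge_entry) => //.
- by move=> x k; rewrite grundy_coveringP.
- by move=> x k; rewrite /edge_count -sum_ones.
- by move=> x k; rewrite holds_eq; apply: eqP.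
Qed.

Theorem theorem19 :
  in_W 3 grundy_domination /\
  in_W 3 total_grundy_domination /\
  in_W 3 one_sided_grundy_total_domination /\
  in_W 3 L_grundy_domination /\
  in_W 3 Z_grundy_domination /\
  in_W 3 grundy_covering.
Proof.
(* [nbhd] reduces to [cln] or [opn] on a concrete boolean, so the four graph problems are instances
   up to conversion. *)
split; first exact: (in_W_graph_problem true true).
split; first exact: (in_W_graph_problem false false).
split; first exact: in_W_one_sided.
split; first exact: (in_W_graph_problem true false).
split; first exact: (in_W_graph_problem false true).
exact: in_W_grundy_covering.
Qed.
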